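(* Let $(A,[\,,\,],\rho)$ be a Lie algebroid over $M$, $\phi_0\in\Gamma(A^* )$ a 1-cocycle and $P\in\Gamma(\wedge^2A)$ a bisection of $A\to M$ satisfying $[P,P]_{\phi_0}=0$. Then: (i) The dual bundle $A^*\to M$ together with the bracket on $\Gamma(A^* )$ defined by $$[\phi,\psi]_{*P}=(\mathcal L_{\phi_0})_{\#_P(\phi)}\psi-(\mathcal L_{\phi_0})_{\#_P(\psi)}\phi-d_{\phi_0}(P(\phi,\psi)),\qquad\phi,\psi\in\Gamma(A^* ),$$ and the bundle map $\rho_{*P}=\rho\circ\#_P:A^*\to TM$ is a Lie algebroid. (ii) $X_0=-\#_P(\phi_0)\in\Gamma(A)$ is a 1-cocycle (of the Lie algebroid $(A^*,[\,,\,]_{*P},\rho_{*P})$). (iii) The pair $((A,\phi_0),(A^*,X_0))$ is a generalized Lie bialgebroid.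
   Context: Lie algebroid $(A,[\,,\,],\rho)$ over $M$: real vector bundle $A\to M$, Lie bracket on $\Gamma(A)$, anchor $\rho:A\to TM$ inducing a Lie algebra homomorphism $\Gamma(A)\to\mathfrak X(M)$, with $[X,fY]=f[X,Y]+\rho(X)(f)Y$. Its differential $d:\Gamma(\wedge^kA^* )\to\Gamma(\wedge^{k+1}A^* )$ is $(d\omega)(X_0,\dots,X_k)=\sum_i(-1)^i\rho(X_i)(\omega(\dots,\hat X_i,\dots))+\sum_{i<j}(-1)^{i+j}\omega([X_i,X_j],\dots,\hat X_i,\dots,\hat X_j,\dots)$. $\phi_0\in\Gamma(A^* )$ is a 1-cocycle if $d\phi_0=0$. Schouten bracket on $\Gamma(\wedge^*A)$: the $\mathbb R$-bilinear extension of the bracket with $[X,f]=\rho(X)(f)$, $[P,P']=(-1)^{kk'}[P',P]$, $[P,P'\wedge P'']=[P,P']\wedge P''+(-1)^{k'(k+1)}P'\wedge[P,P'']$ ($k,k'$ the degrees of $P,P'$). For a 1-cocycle $\phi_0$ of $A$: the $\phi_0$-differential is $d_{\phi_0}\omega=d\omega+\phi_0\wedge\omega$; the $\phi_0$-Lie derivative on $\Gamma(\wedge^kA^* )$ is $(\mathcal L_{\phi_0})_X=d_{\phi_0}\circ i_X+i_X\circ d_{\phi_0}$; the $\phi_0$-Schouten bracket is $[P,P']_{\phi_0}=[P,P']+(-1)^{k+1}(k-1)P\wedge i_{\phi_0}P'-(k'-1)(i_{\phi_0}P)\wedge P'$ (contraction in the first slot); for $P\in\Gamma(\wedge^kA)$,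 $(\mathcal L_{\phi_0})_XP=[X,P]_{\phi_0}$. For $P\in\Gamma(\wedge^2A)$, $\#_P:\Gamma(A^* )\to\Gamma(A)$ (and the associated bundle map $A^*\to A$) is defined by $\beta(\#_P(\alpha))=P(\alpha,\beta)$. Generalized Lie bialgebroid: let $A\to M$ be a vector bundle with Lie algebroid structures $([\,,\,],\rho)$ on $A$ and $([\,,\,]_*,\rho_* )$ on the dual bundle $A^*$, $\phi_0\in\Gamma(A^* )$ a 1-cocycle of $A$ and $X_0\in\Gamma(A)$ a 1-cocycle of $A^*$. Let $d_*$, $d_{*X_0}$, $\mathcal L_{*X_0}$ be the differential, $X_0$-differential and $X_0$-Lie derivative of $A^*$ (acting on $\Gamma(\wedge^kA)$). The pair $((A,\phi_0),(A^*,X_0))$ is a generalized Lie bialgebroid over $M$ if for all $X,Y\in\Gamma(A)$ and $Q\in\Gamma(\wedge^kA)$ (all $k$): $$d_{*X_0}[X,Y]=[X,d_{*X_0}Y]_{\phi_0}-[Y,d_{*X_0}X]_{\phi_0},\qquad(\mathcal L_{*X_0})_{\phi_0}Q+(\mathcal L_{\phi_0})_{X_0}Q=0.$$ In (iii), $A^*$ carries the structure $([\,,\,]_{*P},\rho_{*P})$. *)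

(* Defs.v *)
From HB Require Import structures.
From mathcomp Require Import all_boot all_order all_algebra.
From mathcomp Require Import all_classical all_reals all_analysis.

Set Implicit Arguments.
Unset Strict Implicit.
Unset Printing Implicit Defensive.

Import Order.TTheory GRing.Theory Num.Theory.
Import numFieldNormedType.Exports.

Local Open Scope classical_set_scope.
Local Open Scope ring_scope.

Definition iter_partial (R : realType) (n : nat) (s : seq 'I_n)
    (f : 'rV[R]_n -> R) : 'rV[R]_n -> R :=
  foldr (fun j g y => 'D_(delta_mx 0 j) g y) f s.

(* All iterated partial derivatives exist and are continuous on the open
   set D. *)
Definition smooth_on (R : realType) (n : nat) (D : set 'rV[R]_n)
    (f : 'rV[R]_n -> R) : Prop :=
  forall (s : seq 'I_n) (y : 'rV[R]_n), D y ->
    {for y, continuous (iter_partial s f)} /\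
    forall j : 'I_n, derivable (iter_partial s f) y (delta_mx 0 j).

Record manifold (R : realType) (n : nat) := Manifold {
  mcarrier :> topologicalType;
  mhausdorff : hausdorff_space mcarrier;
  msecond_countable : @second_countable mcarrier;
  mindex : Type;
  mdom : mindex -> set mcarrier;
  mchart : mindex -> mcarrier -> 'rV[R]_n;
  mparam : mindex -> 'rV[R]_n -> mcarrier;
  mdom_open : forall i, open (mdom i);
  mdom_cover : forall x, exists i, mdom i x;
  mimage_open : forall i, open (mchart i @` mdom i);
  mchartK : forall i x, mdom i x -> mparam i (mchart i x) = x;
  mchart_continuous : forall i, {within mdom i, continuous (mchart i)};
  mparam_continuous :
    forall i, {within mchart i @` mdom i, continuous (mparam i)};
  mtransition_smooth : forall i j (k : 'I_n),
    smooth_on (mchart i @` (mdom i `&` mdom j))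
              (fun y => mchart j (mparam i y) 0 k)
}.

Definition msmooth_on (R : realType) (n : nat) (M : manifold R n)
    (U : set M) (f : M -> R) : Prop :=
  forall i : mindex M,
    smooth_on (mchart i @` (mdom i `&` U)) (fun y => f (mparam i y)).

(* The elements of C^oo(M, R). *)
Definition msmooth (R : realType) (n : nat) (M : manifold R n)
    (f : M -> R) : Prop := msmooth_on setT f.

(* A tangent vector at x is a derivation at x of the algebra C^oo(M, R); its
   values on functions that are not smooth carry no information. *)
Definition is_tangent_vector (R : realType) (n : nat) (M : manifold R n)
    (x : M) (v : (M -> R) -> R) : Prop :=
  (forall (a : R) (f g : M -> R), msmooth f -> msmooth g ->
     v (fun y => a * f y + g y) = a * v f + v g) /\
  (forall f g : M -> R, msmooth f -> msmooth g ->
     v (fun y => f y * g y) = v f * g x + f x * v g).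

(* A vector bundle of rank r given by its fibres and by local frames over an
   open cover with smooth transition functions. The frames determine the local
   trivializations, hence the topology and smooth structure of the total
   space. The value of a frame outside its domain carries no information. *)
Record vbundle (R : realType) (n : nat) (M : manifold R n) (r : nat) :=
  VBundle {
  fib :> M -> vectType R;
  vindex : Type;
  vdom : vindex -> set M;
  vframe : vindex -> forall x : M, r.-tuple (fib x);
  vdom_open : forall i, open (vdom i);
  vdom_cover : forall x, exists i, vdom i x;
  vframe_basis : forall i x, vdom i x -> basis_of fullv (vframe i x);
  vtransition_smooth : forall i j (k l : 'I_r),
    msmooth_on (vdom i `&` vdom j)
               (fun x => coord (vframe i x) k (tnth (vframe j x) l))
}.

Definition vsection (R : realType) (n : nat) (M : manifold R n) (r : nat)
    (A : vbundle M r) : Type := forall x : M, A x.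

(* The elements of Gamma(A). *)
Definition smooth_section (R : realType) (n : nat) (M : manifold R n)
    (r : nat) (A : vbundle M r) (X : vsection A) : Prop :=
  forall (i : vindex A) (k : 'I_r),
    msmooth_on (vdom i) (fun x => coord (vframe i x) k (X x)).

(* A smooth section with value v at x; one exists for every v. *)
Definition extend (R : realType) (n : nat) (M : manifold R n) (r : nat)
    (A : vbundle M r) (x : M) (v : A x) : vsection A :=
  xget (fun y => 0 : A y) [set X : vsection A | smooth_section X /\ X x = v].

Lemma iter_partial_ext (R : realType) (n : nat) (D : set 'rV[R]_n)
    (f g : 'rV[R]_n -> R) (s : seq 'I_n) :
  open D -> (forall y, D y -> f y = g y) ->
  forall y, D y -> iter_partial s f y = iter_partial s g y.
Proof.
move=> oD fg; elim: s => [//|j s IHs] y Dy /=.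
apply: near_eq_derive; near=> z; apply: IHs.
by near: z; exact: open_nbhs_nbhs.
Unshelve. all: by end_near. Qed.

Lemma smooth_on_ext (R : realType) (n : nat) (D : set 'rV[R]_n)
    (f g : 'rV[R]_n -> R) :
  open D -> (forall y, D y -> f y = g y) -> smooth_on D f -> smooth_on D g.
Proof.
move=> oD fg sf s y Dy; have [cf df] := sf s y Dy.
have E : {near y, iter_partial s f =1 iter_partial s g}.
  near=> z; apply: (iter_partial_ext s oD fg).
  by near: z; exact: open_nbhs_nbhs.
split=> [|j]; last exact: (near_eq_derivable E (df j)).
rewrite /prop_for /continuous_at -(iter_partial_ext s oD fg Dy).
exact: cvg_trans (near_eq_cvg E) cf.
Unshelve. all: by end_near. Qed.

Lemma mchart_image_open (R : realType) (n : nat) (M : manifold R n)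
    (i : mindex M) (U : set M) :
  open U -> open (mchart i @` (mdom i `&` U)).
Proof.
move=> oU; rewrite openE => _ [x [ix Ux] <-].
have oI : open (mchart i @` mdom i) by exact: mimage_open.
have : {within mchart i @` mdom i, continuous (mparam (m := M) i)}.
  exact: mparam_continuous.
rewrite continuous_open_subspace //.
have Ix : (mchart i @` mdom i) (mchart i x) by exists x.
move=> /(_ _ (mem_set Ix)); rewrite /continuous_at mchartK // => cp.
have : nbhs (mchart i x) (mparam i @^-1` U).
  by apply: cp; exact: open_nbhs_nbhs.
have : nbhs (mchart i x) (mchart i @` mdom i) by exact: open_nbhs_nbhs.
apply: filterS2 => _ [z iz <-] /=; rewrite mchartK // => Uz.
by exists z.
Qed.

Lemma msmooth_on_ext (R : realType) (n : nat) (M : manifold R n) (U : set M)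
    (f g : M -> R) :
  open U -> (forall x, U x -> f x = g x) -> msmooth_on U f -> msmooth_on U g.
Proof.
move=> oU fg sf i; apply: smooth_on_ext (sf i); first exact: mchart_image_open.
by move=> _ [x [ix Ux] <-]; rewrite mchartK // fg.
Qed.

Section DualBundle.
Variables (R : realType) (n : nat) (M : manifold R n) (r : nat).
Variable A : vbundle M r.

Definition dual_fib (x : M) : vectType R := 'Hom(A x, R^o).

Definition dual_frame (i : vindex A) (x : M) : r.-tuple (dual_fib x) :=
  [tuple linfun (coord (vframe i x) k : A x -> R^o) | k < r].

Lemma dual_frameE (i : vindex A) (x : M) (k : 'I_r) (v : A x) :
  (tnth (dual_frame i x) k : 'Hom(A x, R^o)) v = coord (vframe i x) k v.
Proof. by rewrite tnth_mktuple lfunE. Qed.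

Lemma dual_frame_expand (i : vindex A) (x : M) (f : dual_fib x) :
  vdom i x ->
  f = \sum_(k < r) (f : 'Hom(A x, R^o)) (vframe i x)`_k
                   *: (dual_frame i x)`_k.
Proof.
move=> xi; apply/lfunP => v.
rewrite {1}(coord_basis (vframe_basis xi) (memvf v)) linear_sum sum_lfunE.
apply: eq_bigr => k _.
by rewrite linearZ scale_lfunE -[(dual_frame i x)`_k]tnth_nth dual_frameE
           ![_ *: _]mulrC.
Qed.

Lemma dual_frame_free (i : vindex A) (x : M) :
  vdom i x -> free (dual_frame i x).
Proof.
move=> xi; have /andP[_ frx] := vframe_basis xi.
apply/freeP => c c0 k.
have := congr1 (fun f : 'Hom(A x, R^o) => f (vframe i x)`_k) c0.
rewrite sum_lfunE zero_lfunE => <-.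
have E l : (c l *: (dual_frame i x)`_l : 'Hom(A x, R^o)) (vframe i x)`_k =
           c l * (k == l)%:R.
  rewrite scale_lfunE -[(dual_frame i x)`_l]tnth_nth dual_frameE.
  by rewrite coord_free.
rewrite (eq_bigr _ (fun l _ => E l)) (bigD1 k) //= eqxx mulr1 big1 ?addr0 //.
by move=> l; rewrite eq_sym => /negbTE ->; rewrite mulr0.
Qed.

Lemma dual_frame_basis (i : vindex A) (x : M) :
  vdom i x -> basis_of fullv (dual_frame i x).
Proof.
move=> xi; rewrite /basis_of dual_frame_free // andbT eqEsubv subvf /=.
apply/subvP => f _; rewrite (dual_frame_expand f xi).
apply: memv_suml => k _; apply/memvZ/memv_span/mem_nth.
by rewrite size_tuple.
Qed.

Lemma dual_frame_coord (i : vindex A) (x : M) (k : 'I_r) (f : dual_fib x) :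
  vdom i x ->
  coord (dual_frame i x) k f = (f : 'Hom(A x, R^o)) (tnth (vframe i x) k).
Proof.
move=> xi; rewrite {1}(dual_frame_expand f xi).
by rewrite coord_sum_free ?dual_frame_free // -tnth_nth.
Qed.

Lemma dual_transition_smooth (i j : vindex A) (k l : 'I_r) :
  msmooth_on (vdom i `&` vdom j)
             (fun x => coord (dual_frame i x) k (tnth (dual_frame j x) l)).
Proof.
have oU : open (vdom i `&` vdom j) by apply: openI; exact: vdom_open.
apply: (@msmooth_on_ext _ _ _ _
  (fun x => coord (vframe j x) l (tnth (vframe i x) k))) => //.
  by move=> x [xi xj]; rewrite dual_frame_coord // dual_frameE.
by rewrite setIC; exact: vtransition_smooth.
Qed.

Definition dual : vbundle M r :=
  @VBundle R n M r dual_fib (vindex A) (@vdom _ _ _ _ A) dual_frame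
    (@vdom_open _ _ _ _ A) (@vdom_cover _ _ _ _ A) dual_frame_basis
    dual_transition_smooth.

End DualBundle.

(* An element of the sum over k of the fibrewise alternating k-linear forms on
   a bundle B, evaluated on lists of vectors of the fibre at x; its component
   of degree k is the restriction to lists of length k. *)
Definition form (R : realType) (n : nat) (M : manifold R n) (r : nat)
    (B : vbundle M r) : Type := forall x : M, seq (B x) -> R.

(* w is a smooth section of the k-th exterior power of the dual of B. *)
Definition is_form (R : realType) (n : nat) (M : manifold R n) (r : nat)
    (B : vbundle M r) (k : nat) (w : form B) : Prop :=
  [/\ forall x (s : seq (B x)), size s != k -> w x s = 0,
      forall x (s1 s2 : seq (B x)) (a : R) (u v : B x),
        w x (s1 ++ (a *: u + v) :: s2) =
        a * w x (s1 ++ u :: s2) + w x (s1 ++ v :: s2),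
      forall x (s1 s2 s3 : seq (B x)) (u : B x),
        w x (s1 ++ u :: s2 ++ u :: s3) = 0
    & forall (i : vindex B) (I : seq 'I_r),
        msmooth_on (vdom i)
                   (fun x => w x [seq tnth (vframe i x) l | l <- I])].

(* The elements of Gamma(/\^k A) are the alternating k-linear forms on A^*. *)
Notation multivector A := (form (dual A)).
Notation is_multivector A := (@is_form _ _ _ _ (dual A)).

(* Sections of A^* as forms of degree 1 on A, sections of A as multivectors of
   degree 1, and functions as forms of degree 0. *)
Definition form_of_covector (R : realType) (n : nat) (M : manifold R n)
    (r : nat) (A : vbundle M r) (phi : vsection (dual A)) : form A :=
  fun x s => if s is [:: v] then (phi x : 'Hom(A x, R^o)) v else 0.
Arguments form_of_covector {R n M r A} phi x s.

Definition mvec_of_vector (R : realType) (n : nat) (M : manifold R n)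
    (r : nat) (A : vbundle M r) (X : vsection A) : multivector A :=
  fun x s => if s is [:: a] then (a : 'Hom(A x, R^o)) (X x) else 0.
Arguments mvec_of_vector {R n M r A} X x s.

Definition form_of_fun (R : realType) (n : nat) (M : manifold R n) (r : nat)
    (B : vbundle M r) (f : M -> R) : form B :=
  fun x s => if s is [::] then f x else 0.
Arguments form_of_fun {R n M r} B f x s.

(* The wedge product as a sum over shuffles, in the normalization
   (a /\ b)(u, v) = a(u) b(v) - a(v) b(u). The mask m selects the arguments of
   the first factor; the sign is that of the corresponding shuffle. *)
Definition wedge (R : realType) (n : nat) (M : manifold R n) (r : nat)
    (B : vbundle M r) (w h : form B) : form B :=
  fun x s =>
    \sum_(m : (size s).-tuple bool)
      (-1) ^+ (\sum_(i < size s) \sum_(j < size s | (j < i)%N)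
                 (tnth m i && ~~ tnth m j)) *
      (w x (mask m s) * h x (mask (map negb m) s)).
Arguments wedge {R n M r B} w h x s.

Definition contract (R : realType) (n : nat) (M : manifold R n) (r : nat)
    (B : vbundle M r) (X : vsection B) (w : form B) : form B :=
  fun x s => w x (X x :: s).
Arguments contract {R n M r B} X w x s.

Record algebroid_data (R : realType) (n : nat) (M : manifold R n) (r : nat)
    (A : vbundle M r) := AlgebroidData {
  abracket : vsection A -> vsection A -> vsection A;
  anchor : forall x : M, A x -> (M -> R) -> R
}.

Definition anchor_field (R : realType) (n : nat) (M : manifold R n) (r : nat)
    (A : vbundle M r) (L : algebroid_data A) (X : vsection A) (f : M -> R) :
    M -> R :=
  fun x => anchor L (X x) f.

(* The anchor is fibrewise a linear map to the tangent space, and smooth as a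
   bundle map: it sends smooth sections to smooth vector fields. *)
Definition is_lie_algebroid (R : realType) (n : nat) (M : manifold R n)
    (r : nat) (A : vbundle M r) (L : algebroid_data A) : Prop :=
  [/\ (forall X Y : vsection A, smooth_section X -> smooth_section Y ->
         smooth_section (abracket L X Y)) /\
      (forall (a : R) (X Y Z : vsection A), smooth_section X ->
         smooth_section Y -> smooth_section Z -> forall x,
         abracket L (fun y => a *: X y + Y y) Z x =
         a *: abracket L X Z x + abracket L Y Z x),
      (forall X Y : vsection A, smooth_section X -> smooth_section Y ->
         forall x, abracket L X Y x = - abracket L Y X x) /\
      (forall X Y Z : vsection A, smooth_section X -> smooth_section Y ->
         smooth_section Z -> forall x,
         abracket L (abracket L X Y) Z x + abracket L (abracket L Y Z) X x +
         abracket L (abracket L Z X) Y x = 0),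
      [/\ forall x (v : A x), is_tangent_vector x (anchor L v),
          forall x (a : R) (u v : A x) (f : M -> R), msmooth f ->
            anchor L (a *: u + v) f = a * anchor L u f + anchor L v f
        & forall (X : vsection A) (f : M -> R), smooth_section X ->
            msmooth f -> msmooth (anchor_field L X f)],
      (forall (X Y : vsection A) (f : M -> R), smooth_section X ->
         smooth_section Y -> msmooth f -> forall x,
         anchor_field L (abracket L X Y) f x =
         anchor_field L X (anchor_field L Y f) x -
         anchor_field L Y (anchor_field L X f) x)
    & (forall (X Y : vsection A) (f : M -> R), smooth_section X ->
         smooth_section Y -> msmooth f -> forall x,
         abracket L X (fun y => f y *: Y y) x =
         f x *: abracket L X Y x + anchor_field L X f x *: Y x)].

Definition remove_nth (T : Type) (i : nat) (s : seq T) : seq T :=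
  take i s ++ drop i.+1 s.

Definition eval_form (R : realType) (n : nat) (M : manifold R n) (r : nat)
    (B : vbundle M r) (w : form B) (Xs : seq (vsection B)) : M -> R :=
  fun y => w y [seq X y | X <- Xs].

(* (d w)(X_0, ..., X_k) for sections X_0, ..., X_k. *)
Definition koszul (R : realType) (n : nat) (M : manifold R n) (r : nat)
    (B : vbundle M r) (L : algebroid_data B) (w : form B)
    (Xs : seq (vsection B)) : M -> R :=
  let X i := nth (fun y => 0 : B y) Xs i in
  fun x =>
    \sum_(i < size Xs)
      (-1) ^+ i * anchor_field L (X i) (eval_form w (remove_nth i Xs)) x +
    \sum_(i < size Xs) \sum_(j < size Xs | (i < j)%N)
      (-1) ^+ (i + j) *
      eval_form w (abracket L (X i) (X j) ::
                   remove_nth i (remove_nth j Xs)) x.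

(* The right-hand side depends on the sections only through their values at
   x. *)
Definition diff_form (R : realType) (n : nat) (M : manifold R n) (r : nat)
    (B : vbundle M r) (L : algebroid_data B) (w : form B) : form B :=
  fun x s => koszul L w [seq extend v | v <- s] x.
Arguments diff_form {R n M r B} L w x s.

Definition closed_form (R : realType) (n : nat) (M : manifold R n) (r : nat)
    (B : vbundle M r) (L : algebroid_data B) (w : form B) : Prop :=
  forall x s, diff_form L w x s = 0.

Definition cocycle (R : realType) (n : nat) (M : manifold R n) (r : nat)
    (A : vbundle M r) (L : algebroid_data A) (phi : vsection (dual A)) :
    Prop :=
  smooth_section phi /\ closed_form L (form_of_covector phi).

(* 1-cocycles of a Lie algebroid A^*: a section of (A^* )^* is a section of A. *)
Definition dual_cocycle (R : realType) (n : nat) (M : manifold R n) (r : nat)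
    (A : vbundle M r) (Ls : algebroid_data (dual A)) (X : vsection A) : Prop :=
  smooth_section X /\ closed_form Ls (mvec_of_vector X).

(* The twisted differential and Lie derivative defined by a 1-cocycle th,
   given as a form of degree 1. *)
Definition tdiff (R : realType) (n : nat) (M : manifold R n) (r : nat)
    (B : vbundle M r) (L : algebroid_data B) (th w : form B) : form B :=
  fun x s => diff_form L w x s + wedge th w x s.
Arguments tdiff {R n M r B} L th w x s.

Definition tlie (R : realType) (n : nat) (M : manifold R n) (r : nat)
    (B : vbundle M r) (L : algebroid_data B) (th : form B) (X : vsection B)
    (w : form B) : form B :=
  fun x s => tdiff L th (contract X w) x s + contract X (tdiff L th w) x s.
Arguments tlie {R n M r B} L th X w x s.

(* S is the Schouten bracket of L: the axioms have a solution, and they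
   determine S P Q for all P in Gamma(/\^k A) and Q in Gamma(/\^l A). It has
   degree -1; since k + l - 1 would truncate, degrees 0 and 0 are a separate
   clause. *)
Definition is_schouten (R : realType) (n : nat) (M : manifold R n) (r : nat)
    (A : vbundle M r) (L : algebroid_data A)
    (S : multivector A -> multivector A -> multivector A) : Prop :=
  [/\ (forall k l m P Q, is_multivector A k P -> is_multivector A l Q ->
         (k + l = m.+1)%N -> is_multivector A m (S P Q)) /\
      (forall P Q, is_multivector A 0 P -> is_multivector A 0 Q ->
         forall x s, S P Q x s = 0),
      (forall (a : R) k l P P' Q, is_multivector A k P ->
         is_multivector A k P' -> is_multivector A l Q -> forall x s,
         S (fun y t => a * P y t + P' y t) Q x s = a * S P Q x s + S P' Q x s) /\
      (forall (a : R) k l P Q Q', is_multivector A k P ->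
         is_multivector A l Q -> is_multivector A l Q' -> forall x s,
         S P (fun y t => a * Q y t + Q' y t) x s = a * S P Q x s + S P Q' x s),
      (forall X Y : vsection A, smooth_section X -> smooth_section Y ->
         forall x s, S (mvec_of_vector X) (mvec_of_vector Y) x s =
                     mvec_of_vector (abracket L X Y) x s) /\
      (forall (X : vsection A) (f : M -> R), smooth_section X -> msmooth f ->
         forall x s, S (mvec_of_vector X) (form_of_fun (dual A) f) x s =
                     form_of_fun (dual A) (anchor_field L X f) x s),
      (forall k k' P P', is_multivector A k P -> is_multivector A k' P' ->
         forall x s, S P P' x s = (-1) ^+ (k * k') * S P' P x s)
    & (forall k k' k'' P P' P'', is_multivector A k P ->
         is_multivector A k' P' -> is_multivector A k'' P'' -> forall x s,
         S P (wedge P' P'') x s =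
         wedge (S P P') P'' x s +
         (-1) ^+ (k' * k.+1) * wedge P' (S P P'') x s)].

Definition tschouten (R : realType) (n : nat) (M : manifold R n) (r : nat)
    (A : vbundle M r) (S : multivector A -> multivector A -> multivector A)
    (phi : vsection (dual A)) (k k' : nat) (P P' : multivector A) :
    multivector A :=
  fun x s =>
    S P P' x s +
    (-1) ^+ k.+1 * (k%:R - 1) * wedge P (contract phi P') x s -
    (k'%:R - 1) * wedge (contract phi P) P' x s.
Arguments tschouten {R n M r A} S phi k k' P P' x s.

(* S stands for the Schouten bracket of A. *)
Definition is_gen_lie_bialgebroid (R : realType) (n : nat)
    (M : manifold R n) (r : nat) (A : vbundle M r) (L : algebroid_data A)
    (S : multivector A -> multivector A -> multivector A)
    (phi : vsection (dual A)) (Ls : algebroid_data (dual A))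
    (X0 : vsection A) : Prop :=
  [/\ is_lie_algebroid L /\ is_schouten L S, is_lie_algebroid Ls,
      cocycle L phi /\ dual_cocycle Ls X0,
      (forall X Y : vsection A, smooth_section X -> smooth_section Y ->
         forall x s,
         tdiff Ls (mvec_of_vector X0) (mvec_of_vector (abracket L X Y)) x s =
         tschouten S phi 1 2 (mvec_of_vector X)
           (tdiff Ls (mvec_of_vector X0) (mvec_of_vector Y)) x s -
         tschouten S phi 1 2 (mvec_of_vector Y)
           (tdiff Ls (mvec_of_vector X0) (mvec_of_vector X)) x s)
    & (forall k Q, is_multivector A k Q -> forall x s,
         tlie Ls (mvec_of_vector X0) phi Q x s +
         tschouten S phi 1 k (mvec_of_vector X0) Q x s = 0)].

(* The unique v with b(v) = P(a, b) for all b. *)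
Definition sharp (R : realType) (n : nat) (M : manifold R n) (r : nat)
    (A : vbundle M r) (P : multivector A) (x : M) (a : dual A x) : A x :=
  xget 0 [set v : A x |
            forall b : dual A x, (b : 'Hom(A x, R^o)) v = P x [:: a; b]].

Definition sharp_section (R : realType) (n : nat) (M : manifold R n)
    (r : nat) (A : vbundle M r) (P : multivector A)
    (phi : vsection (dual A)) : vsection A :=
  fun x => sharp P (phi x).

Definition bracketP (R : realType) (n : nat) (M : manifold R n) (r : nat)
    (A : vbundle M r) (L : algebroid_data A) (phi0 : vsection (dual A))
    (P : multivector A) (phi psi : vsection (dual A)) : vsection (dual A) :=
  let th := form_of_covector phi0 in
  fun x => linfun (fun v : A x =>
    (tlie L th (sharp_section P phi) (form_of_covector psi) x [:: v] -
     tlie L th (sharp_section P psi) (form_of_covector phi) x [:: v] -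
     tdiff L th (form_of_fun A (fun y => P y [:: phi y; psi y])) x [:: v])
    : R^o).

Definition dataP (R : realType) (n : nat) (M : manifold R n) (r : nat)
    (A : vbundle M r) (L : algebroid_data A) (phi0 : vsection (dual A))
    (P : multivector A) : algebroid_data (dual A) :=
  {| abracket := bracketP L phi0 P;
     anchor := fun x a => anchor L (sharp P a) |}.

(* Main.v *)
From HB Require Import structures.
Require Import Defs.
From mathcomp Require Import all_boot all_order all_algebra.
From mathcomp Require Import all_classical all_reals all_analysis.
From mathcomp Require Import zify ring lra.
(* The sesquilinear forms of [all_algebra] would otherwise shadow [form]. *)
Import Defs.

(** Write [# a] for [#_P a] and [D_X f = rho(X) f + phi0(X) f], a flat connection
    because [phi0] is closed; in terms of [D] the twisted Cartan calculus is the
    usual one. The hypothesis on [P] says that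
    [sum_cyc D_{#a} P(b, c) = sum_cyc <c, [#a, #b]>], which is the same as
    [#[a, b]_P = [#a, #b]]. The Jacobi identity for [[ , ]_P] reduces to the
    derivative of this identity, and [X0 = - #phi0] is closed since [phi0] is.
    The differential of the dual algebroid satisfies
    [d_{*X0} Y = - (L_Y P - phi0(Y) P)], so the first compatibility condition is
    the commutation of twisted Lie derivatives, and [[phi0, a]_P = - L_{X0} a]
    gives the second one through Cartan's formula.

    The Schouten bracket is only given by its axioms. Its values are found from
    the derivation property and Euler's identity
    [sum_j e_j /\ i_(e^j) Q = k Q] in a frame cut off by a bump function, which
    also makes all the arguments about sections global. *)

Set Implicit Arguments.
Unset Strict Implicit.
Unset Printing Implicit Defensive.

Import Order.TTheory GRing.Theory Num.Theory.
Import numFieldNormedType.Exports.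

Local Open Scope classical_set_scope.
Local Open Scope ring_scope.

(** The twist is a line bundle in disguise. Let [l] be the trivial line bundle with connection [D].
    The twisted Lie derivative adds [phi0(X)] on functions and covectors, and [[X, Q]_phi0]
    subtracts [(k - 1) phi0(X)] in degree [k]. So the values [b(Y)] and [P(a, b)] behave as sections
    of [l], covectors as sections of [A^*] tensor [l], vectors as sections of [A], and [P] takes
    values in the inverse of [l]. These weights are compatible with all pairings and with [#_P],
    which is why the untwisted identities survive with [rho] replaced by [D]. The obstacle is
    locality. Brackets act on global sections, frames are local, and [diff_form] evaluates vectors
    at a point through the arbitrary choice [extend]. Locality has to be extracted from the Leibniz
    rules, which only accept globally smooth coefficients. *)

(** * Calculus of the classes C^k on open sets of R^n *)

Section SmoothFunctions.
Variables (R : realType) (n : nat).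
Implicit Types (D : set 'rV[R]_n) (f g : 'rV[R]_n -> R).

Definition cont_on D f := forall y, D y -> {for y, continuous f}.

Definition partial (j : 'I_n) f : 'rV[R]_n -> R :=
  fun y => 'D_(delta_mx 0 j) f y.

Definition partially_derivable D f :=
  forall j y, D y -> derivable f y (delta_mx 0 j).

(** In [iter_partial] the head of the list is differentiated last. Here [f] itself is differentiated
    first, so that the sum, product and chain rules apply before the induction on [k]. *)
Fixpoint ck (k : nat) D f : Prop :=
  cont_on D f /\
  if k is k'.+1 then
    partially_derivable D f /\ forall j, ck k' D (partial j f)
  else True.

Lemma iter_partial_rcons s j f :
  iter_partial (rcons s j) f = iter_partial s (partial j f).
Proof. by rewrite /iter_partial foldr_rcons. Qed.

Lemma smooth_on_ck D f : smooth_on D f <-> forall k, ck k D f.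
Proof.
split=> [sf k|cf].
  elim: k f sf => [|k IHk] f sf; split=> //; try by move=> y /(sf [::])[].
  split=> [j y /(sf [::])[_]|j]; first exact.
  by apply: IHk => s y /(sf (rcons s j)); rewrite iter_partial_rcons.
move=> s y Dy; elim/last_ind: s f cf => [|s j IHs] f cf.
  by split=> [|j]; [have [c _] := cf 0%N; exact: c|
                    have [_ [d _]] := cf 1%N; exact: d].
rewrite !iter_partial_rcons; apply: IHs => k.
by have [_ [_ d]] := cf k.+1; exact: d.
Qed.

Lemma near_open_eq D f g y : open D -> (forall y, D y -> f y = g y) -> D y ->
  {near y, f =1 g}.
Proof.
move=> oD fg Dy; near=> z; apply: fg; near: z; exact: open_nbhs_nbhs.
Unshelve. all: by end_near. Qed.

Lemma cont_on_ext D f g : open D -> (forall y, D y -> f y = g y) ->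
  cont_on D f -> cont_on D g.
Proof.
move=> oD fg cf y Dy; rewrite /prop_for /continuous_at -(fg _ Dy).
exact: cvg_trans (near_eq_cvg (near_open_eq oD fg Dy)) (cf y Dy).
Qed.

Lemma ck_ext k D f g : open D -> (forall y, D y -> f y = g y) ->
  ck k D f -> ck k D g.
Proof.
move=> oD; elim: k f g => [|k IHk] f g fg /= [cf H].
  by split=> //; exact: cont_on_ext cf.
have E y := @near_open_eq D f g y oD fg.
split; first exact: cont_on_ext cf.
case: H => [df pf]; split=> [j y Dy|j].
  exact: near_eq_derivable (E _ Dy) (df j y Dy).
by apply: IHk (pf j) => y Dy; apply: near_eq_derive; exact: E.
Qed.

Lemma ckW k D f : ck k.+1 D f -> ck k D f.
Proof.
elim: k f => [|k IHk] f /= [cf [df pf]]; split=> //; split=> // j.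
exact: IHk (pf j).
Qed.

Lemma ck_cst k D (a : R) : ck k D (fun=> a).
Proof.
have C b : cont_on D (fun=> b) by move=> y _; exact: cst_continuous.
elim: k a => [|k IHk] a /=; split=> //.
split=> [j y _|j]; first exact: derivable_cst.
suff -> : partial j (fun=> a) = fun=> 0 by exact: IHk.
by apply/funext => y; rewrite /partial (derive_cst a).
Qed.

Lemma ckD k D f g : open D -> ck k D f -> ck k D g ->
  ck k D (fun y => f y + g y).
Proof.
move=> oD; elim: k f g => [|k IHk] f g /= [cf Hf] [cg Hg].
  by split=> // y Dy; exact: (continuousD (cf _ Dy) (cg _ Dy)).
split; first by move=> y Dy; exact: (continuousD (cf _ Dy) (cg _ Dy)).
case: Hf => df pf; case: Hg => dg pg; split=> [j y Dy|j].
  by apply: derivableD; [exact: (df _ _ Dy)|exact: (dg _ _ Dy)].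
apply: ck_ext (IHk _ _ (pf j) (pg j)) => // y Dy.
exact: esym (deriveD (df _ _ Dy) (dg _ _ Dy)).
Qed.

Lemma ckM k D f g : open D -> ck k D f -> ck k D g ->
  ck k D (fun y => f y * g y).
Proof.
move=> oD; elim: k f g => [|k IHk] f g Cf Cg.
  case: Cf Cg => [cf _] [cg _].
  by split=> // y Dy; exact: (continuousM (cf _ Dy) (cg _ Dy)).
have := Cf => -[cf [df pf]]; have := Cg => -[cg [dg pg]].
split; first by move=> y Dy; exact: (continuousM (cf _ Dy) (cg _ Dy)).
split=> [j y Dy|j].
  by apply: derivableM; [exact: (df _ _ Dy)|exact: (dg _ _ Dy)].
apply: ck_ext (ckD oD (IHk _ _ (ckW Cf) (pg j))
                      (IHk _ _ (ckW Cg) (pf j))) => // y Dy.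
exact: esym (deriveM (df _ _ Dy) (dg _ _ Dy)).
Qed.

Lemma ckV k D f : open D -> (forall y, D y -> f y != 0) -> ck k D f ->
  ck k D (fun y => (f y)^-1).
Proof.
move=> oD f0; elim: k => [|k IHk] Cf.
  case: Cf => [cf _].
  by split=> // y Dy; exact: (continuousV (f0 _ Dy) (cf _ Dy)).
have := Cf => -[cf [df pf]].
split; first by move=> y Dy; exact: (continuousV (f0 _ Dy) (cf _ Dy)).
split=> [j y Dy|j].
  by apply: derivableV; [exact: f0|exact: (df _ _ Dy)].
have CV := IHk (ckW Cf).
apply: ck_ext (ckM oD (ckM oD (ck_cst k D (-1)) (ckM oD CV CV)) (pf j)) => //.
move=> y Dy; rewrite /partial [RHS]deriveV ?f0 //; last exact: (df _ _ Dy).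
by rewrite -[RHS]/(_ * _) -exprVn expr2; congr (_ * _); rewrite mulN1r.
Qed.

(** A directional derivative is a derivative along the line [t *: v + y], which reduces this to the
    chain rule in one variable and asks of [f] only derivability in the direction [v]. *)
Lemma derive_comp1 (h : R -> R) (a : R) f y v :
  is_derive (f y) 1 h a -> derivable f y v ->
  derivable (h \o f) y v /\ 'D_v (h \o f) y = a * 'D_v f y.
Proof.
move=> dh df.
have E (F : 'rV[R]_n -> R) : 'D_v F y = 'D_1 (fun t : R => F (t *: v + y)) 0.
  rewrite /derive; set g1 := fun h => h^-1 *: _; set g2 := fun h => h^-1 *: _.
  suff -> : g1 = g2 by [].
  rewrite funeqE /g1 /g2 => t /=.
  by rewrite addr0 scale0r add0r [_%:A]mulr1.
have df1 : is_derive (0 : R) (1 : R) (fun t : R => f (t *: v + y)) ('D_v f y).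
  apply: DeriveDef; last by rewrite -E.
  exact: (derivable1P f y v).1.
have dh1 : is_derive ((fun t : R => f (t *: v + y)) 0) (1 : R) h a.
  by rewrite /= scale0r add0r.
have [d1 d2] := is_derive1_comp dh1 df1.
split; last by rewrite E -d2.
exact: (derivable1P (h \o f) y v).2.
Qed.

Lemma cont_comp1 (h : R -> R) D f :
  (forall t, derivable h t 1) -> cont_on D f -> cont_on D (h \o f).
Proof.
move=> dh cf y Dy; apply: continuous_comp; first exact: (cf _ Dy).
exact/differentiable_continuous/derivable1_diffP.
Qed.

End SmoothFunctions.

(** * The flat function exp(-1/t) *)

Section FlatFunction.
Variable R : realType.

(* [p (1/t) exp (-1/t)], extended by [0] to [t <= 0]: the derivatives of the
   flat function [exp (-1/t)] are all of this shape. *)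
Definition flat (p : {poly R}) (t : R) : R :=
  if 0 < t then p.[t^-1] * expR (- t^-1) else 0.

Lemma poly_bound (p : {poly R}) : exists2 C : R, 0 <= C &
  forall u, 1 <= u -> `|p.[u]| <= C * u ^+ size p.
Proof.
elim/poly_ind: p => [|p c [C C0 HC]].
  by exists 0 => // u _; rewrite horner0 normr0 mul0r.
have [->|p0] := eqVneq p 0.
  exists `|c| => // u u1; rewrite mul0r add0r hornerC size_polyC.
  by case: eqP => [->|_] /=; rewrite ?normr0 ?mul0r // expr1 ler_peMr.
exists (C + `|c|); first exact: addr_ge0.
move=> u u1; rewrite size_MXaddC (negbTE p0) /= hornerMXaddC.
have u0 : 0 <= u by lra.
rewrite (le_trans (ler_normD _ _)) // mulrDl lerD //.
  by rewrite normrM (ger0_norm u0) exprSr mulrA ler_wpM2r // HC.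
by rewrite ler_peMr // exprn_ege1.
Qed.

(** The exponential beats the polynomial in [1/t]. The order 2 in [t] makes the difference quotient
    at [0] tend to [0]. *)
Lemma flat_near0 (p : {poly R}) : exists2 C : R, 0 <= C &
  forall t, `|t| <= 1 -> `|flat p t| <= C * `|t| ^+ 2.
Proof.
have [C C0 HC] := poly_bound p.
(* For [u = 1/t] one has [exp u >= u^(k+2) / (k+2)!]: of these [k + 2] powers, [k] absorb the growth
   of [p] and two remain as [t^2]. *)
set k := size p in HC; exists (C * (k.+2)`!%:R).
  by rewrite mulr_ge0 // ler0n.
move=> t t1; rewrite /flat; case: ifPn => [t0|_]; last first.
  by rewrite normr0 !mulr_ge0 // ler0n.
have u1 : 1 <= t^-1 by rewrite invf_ge1 //; move: t1; rewrite gtr0_norm.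
have u0 : 0 < t^-1 by rewrite invr_gt0.
have E := expR_ge1Dxn k.+1 (ltW u0).
have E1 : t^-1 ^+ k.+2 / k.+2`!%:R <= expR t^-1 by lra.
have E2 : expR (- t^-1) <= k.+2`!%:R * t ^+ k.+2.
  rewrite expRN -[X in _ <= X]invrK lef_pV2 ?posrE ?expR_gt0 //; last first.
    by rewrite invr_gt0 mulr_gt0 ?exprn_gt0 // ltr0n fact_gt0.
  by rewrite invfM mulrC -exprVn.
rewrite normrM (ger0_norm (expR_ge0 _)) (gtr0_norm t0).
apply: le_trans (ler_pM (normr_ge0 _) (expR_ge0 _) (HC _ u1) E2) _.
rewrite le_eqVlt; apply/orP; left; apply/eqP.
rewrite exprVn -addn2 exprD.
field.
by rewrite expf_neq0 // gt_eqF.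
Qed.

(** Since [(1/t)' = - (1/t)^2], differentiating the two factors gives [- X^2 p'] and [X^2 p] at
    [1/t]. At [t = 0] the bound [flat_near0] takes over. *)
Lemma flat_derive (p : {poly R}) (t : R) :
  is_derive t 1 (flat p) (flat ('X^2 * (p - p^`())) t).
Proof.
have [t0|t0|->] := ltgtP t 0.
- apply: (@near_eq_is_derive _ _ _ (fun=> 0)).
    near=> z; rewrite /flat; have -> : (0 < z) = false; last by [].
    by apply/negbTE; rewrite -leNgt; apply/ltW; near: z; exact: lt_nbhsl.
  rewrite /flat [0 < t]lt_gtF //; exact: is_derive_cst.
- apply: (@near_eq_is_derive _ _ _ (fun z : R => p.[z^-1] * expR (- z^-1) : R)).
    near=> z; rewrite /flat; have -> // : (0 < z).
    by near: z; exact: lt_nbhsr.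
  have tn0 : t != 0 by rewrite gt_eqF.
  have dV : is_derive t 1 (fun z : R => z^-1) (- t ^- 2 *: 1).
    exact: (@is_deriveV _ id).
  have dp : is_derive t^-1 1 (fun z => p.[z]) (p^`().[t^-1]).
    exact: is_derive_poly.
  have d1 := @is_derive1_comp _ (fun z => p.[z]) (fun z : R => z^-1) _ _ _ dp dV.
  have dNV : is_derive t 1 (fun z : R => - z^-1) (- (- t ^- 2 *: 1)).
    exact: (@is_deriveN _ _ _ (fun z : R => z^-1)).
  have d2 := @is_derive1_comp _ expR (fun z : R => - z^-1) _ _ _
    (is_derive_expR _) dNV.
  apply: (@is_derive_eq _ _ _ _ _ _ _ _ (is_deriveM d1 d2)).
  rewrite /flat t0 !hornerE /= -![_ *: _]/(_ * _) /= .
  by field.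
- have [C C0 HC] := flat_near0 p.
  have f0 q : flat q 0 = 0 by rewrite /flat ltxx.
  rewrite f0.
  have L : h^-1 *: (flat p (h *: 1 + 0) - flat p 0) @[h --> 0^'] --> (0 : R).
    apply/cvgrPdist_le => e e0.
    near=> h; rewrite sub0r normrN f0 subr0 addr0.
    rewrite -[h *: 1]/(h * 1) mulr1 -[_ *: _]/(_ * _) normrM normfV.
    have h0 : h != 0 by near: h; exact: nbhs_dnbhs_neq.
    have h1 : `|h| <= 1.
      near: h; apply: nbhs_dnbhs; near=> z.
      by near: z; exists 1 => //= z /=; rewrite sub0r normrN => /ltW.
    rewrite ler_pdivrMl ?normr_gt0 //; apply: le_trans (HC _ h1) _.
    rewrite expr2 mulrCA ler_wpM2l //.
    (* [C] may be zero, hence the division by [C + 1]. *)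
    have : `|h| <= e / (C + 1).
      near: h; apply: nbhs_dnbhs; exists (e / (C + 1)) => /=.
        by rewrite divr_gt0 //; lra.
      by move=> z /=; rewrite sub0r normrN => /ltW.
    have C1 : 0 < C + 1 by lra.
    rewrite ler_pdivlMr // => he.
    by apply: le_trans he; rewrite mulrC ler_wpM2l //; lra.
  by split; [apply/cvg_ex; exists 0; exact: L|exact: cvg_lim L].
Unshelve. all: by end_near. Qed.

(** The induction must let [p] vary, because differentiation replaces it by another polynomial. *)
Lemma ck_flat n k (D : set 'rV[R]_n) f p : open D -> ck k D f ->
  ck k D (fun y => flat p (f y)).
Proof.
move=> oD; elim: k f p => [|k IHk] f p Cf.
  case: Cf => [cf _]; split=> //.
  by apply: (@cont_comp1 _ _ (flat p)) cf => t; case: (flat_derive p t).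
have := Cf => -[cf [df pf]].
have H j y (Dy : D y) := derive_comp1 (flat_derive p (f y)) (df j y Dy).
split; first by apply: (@cont_comp1 _ _ (flat p)) cf => t; case: (flat_derive p t).
split=> [j y Dy|j]; first by case: (H j y Dy).
apply: ck_ext (ckM oD (IHk f ('X^2 * (p - p^`())) (ckW Cf)) (pf j)) => // y Dy.
by case: (H j y Dy) => _ <-.
Qed.

End FlatFunction.

(** * Closure properties of smooth functions on an open set *)

Section SmoothOn.
Variables (R : realType) (n : nat) (D : set 'rV[R]_n).
Hypothesis oD : open D.

Lemma smooth_on_cst (a : R) : smooth_on D (fun=> a).
Proof. by apply/smooth_on_ck => k; exact: ck_cst. Qed.

Lemma smooth_onD f g : smooth_on D f -> smooth_on D g ->
  smooth_on D (fun y => f y + g y).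
Proof.
by move=> /smooth_on_ck Hf /smooth_on_ck Hg; apply/smooth_on_ck => k; exact: ckD.
Qed.

Lemma smooth_onM f g : smooth_on D f -> smooth_on D g ->
  smooth_on D (fun y => f y * g y).
Proof.
by move=> /smooth_on_ck Hf /smooth_on_ck Hg; apply/smooth_on_ck => k; exact: ckM.
Qed.

Lemma smooth_onV f : (forall y, D y -> f y != 0) -> smooth_on D f ->
  smooth_on D (fun y => (f y)^-1).
Proof.
by move=> f0 /smooth_on_ck Hf; apply/smooth_on_ck => k; exact: ckV.
Qed.

Lemma smooth_on_flat p f : smooth_on D f -> smooth_on D (fun y => flat p (f y)).
Proof.
by move=> /smooth_on_ck Hf; apply/smooth_on_ck => k; exact: ck_flat.
Qed.

End SmoothOn.

(** * Smooth functions on a manifold and bump functions *)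

Section ManifoldFunctions.
Variables (R : realType) (n : nat) (M : manifold R n).
Implicit Types (U V W : set M) (f g : M -> R).

Lemma msmooth_onS U V f : V `<=` U -> msmooth_on U f -> msmooth_on V f.
Proof.
by move=> VU sf i s _ [y [iy /VU Uy] <-]; apply: sf; exists y.
Qed.

Lemma msmooth_on_local U f :
  (forall x, U x -> exists2 V, V x & msmooth_on V f) -> msmooth_on U f.
Proof.
move=> loc i s _ [y [iy /loc[V Vy sf]] <-]; apply: sf.
by exists y.
Qed.

Lemma msmooth_on_cst U (a : R) : open U -> msmooth_on U (fun=> a).
Proof. by move=> oU i; apply: smooth_on_cst; exact: mchart_image_open. Qed.

Lemma msmooth_onD U f g : open U -> msmooth_on U f -> msmooth_on U g ->
  msmooth_on U (fun x => f x + g x).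
Proof.
move=> oU sf sg i; apply: smooth_onD; [exact: mchart_image_open|exact: sf|].
exact: sg.
Qed.

Lemma msmooth_onM U f g : open U -> msmooth_on U f -> msmooth_on U g ->
  msmooth_on U (fun x => f x * g x).
Proof.
move=> oU sf sg i; apply: smooth_onM; [exact: mchart_image_open|exact: sf|].
exact: sg.
Qed.

Lemma msmooth_onV U f : open U -> (forall x, U x -> f x != 0) ->
  msmooth_on U f -> msmooth_on U (fun x => (f x)^-1).
Proof.
move=> oU f0 sf i; apply: smooth_onV; [exact: mchart_image_open| |exact: sf].
by move=> _ [x [ix Ux] <-]; rewrite mchartK // f0.
Qed.

Lemma msmooth_on_flat U p f : open U -> msmooth_on U f ->
  msmooth_on U (fun x => flat p (f x)).
Proof.
move=> oU sf i; apply: smooth_on_flat; [exact: mchart_image_open|exact: sf].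
Qed.

Lemma msmooth_on_prod U (I : Type) (s : seq I) (F : I -> M -> R) : open U ->
  (forall i, msmooth_on U (F i)) -> msmooth_on U (fun x => \prod_(i <- s) F i x).
Proof.
move=> oU sF; elim: s => [|a s IHs].
  apply: msmooth_on_ext (@msmooth_on_cst U 1 oU) => // x _.
  by rewrite big_nil.
apply: msmooth_on_ext (msmooth_onM oU (sF a) IHs) => // x _.
by rewrite big_cons.
Qed.

Lemma msmooth_on_sum U (I : Type) (s : seq I) (F : I -> M -> R) : open U ->
  (forall i, msmooth_on U (F i)) -> msmooth_on U (fun x => \sum_(i <- s) F i x).
Proof.
move=> oU sF; elim: s => [|a s IHs].
  apply: msmooth_on_ext (@msmooth_on_cst U 0 oU) => // x _.
  by rewrite big_nil.
apply: msmooth_on_ext (msmooth_onD oU (sF a) IHs) => // x _.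
by rewrite big_cons.
Qed.

Lemma msmooth_on_chart i (k : 'I_n) : msmooth_on (mdom i) (fun x : M => mchart i x 0 k).
Proof. by move=> j; exact: mtransition_smooth. Qed.

(** [K] is the image of a compact cube under the parametrization, hence compact and, [M] being
    Hausdorff, closed in all of [M] and not only in the chart. This is what makes extension by zero
    off [K] smooth. *)
Lemma chart_cube (U : set M) x i : open U -> U x -> mdom i x ->
  exists2 d : R, 0 < d &
    exists K, [/\ closed K, K `<=` mdom i `&` U, K x &
      forall y, mdom i y -> (forall k, `|mchart i y 0 k - mchart i x 0 k| <= d) ->
        K y].
Proof.
move=> oU Ux ix.
have Ox : (mchart i @` (mdom i `&` U)) (mchart i x) by exists x.
have : nbhs (mchart i x) (mchart i @` (mdom i `&` U)).
  by apply: open_nbhs_nbhs; split=> //; exact: mchart_image_open.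
move=> /nbhs_ballP[e /= e0 eO]; exists (e / 2); first by rewrite divr_gt0.
(* Balls of row vectors are cubes already; halving the radius makes the closed cube fit. As a
   product of segments it is compact. *)
pose C := [set v : 'rV[R]_n |
  forall k, [set` `[mchart i x 0 k - e / 2, mchart i x 0 k + e / 2]] (v ord0 k)].
have CO : C `<=` mchart i @` (mdom i `&` U).
  move=> v Cv; apply: eO; split=> // a b; rewrite (ord1 a) /ball /=.
  have := Cv b; rewrite /= in_itv /= => /andP[h1 h2].
  by rewrite ltr_norml; apply/andP; split; lra.
have cC : compact C.
  apply: (@rV_compact R n (fun k =>
    [set` `[mchart i x 0 k - e / 2, mchart i x 0 k + e / 2]])) => k.
  exact: segment_compact.
have E y : mdom i y ->
  (forall k, `|mchart i y 0 k - mchart i x 0 k| <= e / 2) -> C (mchart i y).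
  move=> iy H k; rewrite /= in_itv /=.
  by have := H k; rewrite ler_norml => /andP[h1 h2]; apply/andP; split; lra.
have F y : mdom i y ->
  (forall k, `|mchart i y 0 k - mchart i x 0 k| <= e / 2) ->
  (mparam i @` C) y.
  by move=> iy /(E _ iy) Cy; exists (mchart i y) => //; rewrite mchartK.
exists (mparam i @` C); split=> //.
- apply: compact_closed; first exact: mhausdorff.
  apply: continuous_compact => //.
  apply: continuous_subspaceW (@mparam_continuous _ _ M i).
  by move=> v /CO [y [iy _] <-]; exists y.
- by move=> _ [v /CO[y [iy Uy] <-] <-]; rewrite mchartK.
- by apply: F => // k; rewrite subrr normr0 divr_ge0 // ltW.
Qed.

(** The last clause says without closures that the support of [chi] lies in [U]: [chi] vanishes on
    an open set which together with [U] covers [M]. *)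
Definition is_bump U x (chi : M -> R) :=
  [/\ msmooth chi, chi x = 1 &
      exists W, [/\ open W, W `|` U = setT & forall y, W y -> chi y = 0]].

Lemma bump_exists U x : open U -> U x -> exists chi, is_bump U x chi.
Proof.
move=> oU Ux; have [i ix] := mdom_cover x.
have [d d0 [K [cK KU Kx HK]]] := chart_cube oU Ux ix.
(* One factor [exp(-1/t)] per coordinate, at [t = d^2 - (y_k - x_k)^2], so that the product vanishes
   off the cube of half-side [d]. *)
pose b (y : M) := \prod_(k < n)
  flat 1 (d ^+ 2 - (mchart i y 0 k - mchart i x 0 k) ^+ 2).
have b0 : b x != 0.
  apply/prodf_neq0 => k _; rewrite subrr expr0n subr0 /flat exprn_gt0 //.
  by rewrite hornerC mul1r gt_eqF // expR_gt0.
(* Off its domain [mchart i] is arbitrary, so [b] is meaningful only in the chart and is replaced by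
   zero off [K]. Inside the chart this changes nothing. *)
pose chi y := if `[< K y >] then b y / b x else 0.
have oW : open (~` K) by exact: closed_openC.
have W0 y : (~` K) y -> chi y = 0 by rewrite /chi; case: asboolP.
exists chi; split; last first.
- exists (~` K); split=> //; apply/seteqP; split=> // y _.
  by have [/KU[_ Uy]|nKy] := pselect (K y); [right|left].
- by rewrite /chi; case: asboolP => // _; rewrite divff.
have oV : open (mdom i `&` U) by apply: openI => //; exact: mdom_open.
have sV : msmooth_on (mdom i `&` U) chi.
  apply: (@msmooth_on_ext _ _ _ _ (fun y => b y * (b x)^-1)) => //.
    move=> y [iy Uy]; rewrite /chi; case: asboolP => // nKy.
    suff -> : b y = 0 by rewrite mul0r.
    apply/eqP; apply/contra_notT: nKy => by0; apply: HK => // k.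
    move: by0 => /prodf_neq0 /(_ k isT); rewrite /flat.
    case: ifPn; last by rewrite eqxx.
    move=> h _; have h2 : (mchart i y 0 k - mchart i x 0 k) ^+ 2 <= d ^+ 2 by lra.
    rewrite -(ler_pXn2r (n := 2)) ?nnegrE ?normr_ge0 ?(ltW d0) // real_normK ?num_real //.
  apply: msmooth_onM => //; last exact: msmooth_on_cst.
  apply: msmooth_on_prod => // k; apply: msmooth_on_flat => //.
  have H : msmooth_on (mdom i `&` U) (fun y => mchart i y 0 k - mchart i x 0 k).
    apply: msmooth_onD => //; last exact: msmooth_on_cst.
    by apply: msmooth_onS (@msmooth_on_chart i k) => y [].
  apply: (msmooth_on_ext oV _ (msmooth_onD oV (msmooth_on_cst (d ^+ 2) oV)
    (msmooth_onM oV (msmooth_on_cst (-1) oV) (msmooth_onM oV H H)))).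
  by move=> y _; rewrite expr2 mulN1r.
apply: msmooth_on_local => y _.
have [/KU Vy|nKy] := pselect (K y); first by exists (mdom i `&` U).
exists (~` K) => //; apply: msmooth_on_ext (@msmooth_on_cst _ 0 oW) => // z Wz.
by rewrite W0.
Qed.

Lemma msmooth_onbump U x chi f : open U -> is_bump U x chi -> msmooth_on U f ->
  msmooth (fun y => chi y * f y).
Proof.
move=> oU [schi _ [W [oW WU W0]]] sf; apply: msmooth_on_local => y _.
have : (W `|` U) y by rewrite WU.
case=> [Wy|Uy].
  exists W => //; apply: msmooth_on_ext (@msmooth_on_cst _ 0 oW) => // z Wz.
  by rewrite W0 // mul0r.
exists U; first exact: Uy.
by apply: msmooth_onM sf; [exact: oU|exact: msmooth_onS schi].
Qed.

Lemma msmooth_continuous f : msmooth f -> continuous f.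
Proof.
move=> sf x; have [i ix] := mdom_cover x.
have [cf _] : {for mchart i x, continuous (fun y => f (mparam i y))} /\
   forall j, derivable (fun y => f (mparam i y)) (mchart i x) (delta_mx 0 j).
  by apply: (sf i [::]); exists x.
have := @mchart_continuous _ _ M i.
rewrite continuous_open_subspace; last exact: mdom_open.
move=> /(_ x (mem_set ix)) cc.
have : {for x, continuous ((fun y => f (mparam i y)) \o mchart i)}.
  exact: continuous_comp.
rewrite /prop_for /continuous_at /= mchartK // => H.
apply: cvg_trans H; apply: near_eq_cvg; near=> y.
rewrite /= mchartK //; near: y.
by apply: open_nbhs_nbhs; split=> //; exact: mdom_open.
Unshelve. all: by end_near. Qed.

Lemma bump_neq0_open U x chi : is_bump U x chi -> open [set y | chi y != 0].
Proof.
case=> schi _ _; have := @open_comp _ _ chi [set t | t != 0].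
apply; first by move=> y _; exact: msmooth_continuous.
exact: open_neq.
Qed.

Lemma bump_subset U x chi y : is_bump U x chi -> chi y != 0 -> U y.
Proof.
case=> _ _ [W [_ WU W0]]; have : (W `|` U) y by rewrite WU.
by case=> // /W0 ->; rewrite eqxx.
Qed.

End ManifoldFunctions.

(** * Smooth sections and the tensoriality principle *)

Section BundleSections.
Variables (R : realType) (n : nat) (M : manifold R n) (r : nat).

(** Near [x] the function [f] is the quotient of the global function [chi * f] by [chi]. This turns
    the smoothness of components in a local frame into a statement about pairings with global
    sections. *)
Lemma msmooth_on_bumpP (U : set M) (f : M -> R) : open U ->
  (forall x chi, U x -> is_bump U x chi -> msmooth (fun y => chi y * f y)) ->
  msmooth_on U f.
Proof.
move=> oU H; apply: msmooth_on_local => x Ux.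
have [chi bchi] := bump_exists oU Ux.
have oV := bump_neq0_open bchi.
exists [set y | chi y != 0]; first by case: bchi => _ + _ => /= ->; exact: oner_neq0.
have S1 : msmooth_on [set y | chi y != 0] (fun y => chi y * f y).
  exact: msmooth_onS (H x chi Ux bchi).
have S2 : msmooth_on [set y | chi y != 0] (fun y => (chi y)^-1).
  apply: (msmooth_onV oV (fun y h => h)).
  by case: bchi => schi _ _; exact: msmooth_onS schi.
apply: msmooth_on_ext oV _ (msmooth_onM oV S2 S1) => y /= chi0.
by rewrite mulKf.
Qed.

Lemma msmooth_cst (a : R) : msmooth (M := M) (fun=> a).
Proof. by apply: msmooth_on_cst; exact: openT. Qed.

Lemma msmoothD (f g : M -> R) : msmooth f -> msmooth g ->
  msmooth (fun x => f x + g x).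
Proof. by move=> sf sg; apply: msmooth_onD sf sg; exact: openT. Qed.

Lemma msmoothM (f g : M -> R) : msmooth f -> msmooth g ->
  msmooth (fun x => f x * g x).
Proof. by move=> sf sg; apply: msmooth_onM sf sg; exact: openT. Qed.

Lemma msmoothN (f : M -> R) : msmooth f -> msmooth (fun x => - f x).
Proof.
move=> sf; have := msmoothM (msmooth_cst (-1)) sf.
by congr (msmooth _); apply/funext => x; rewrite mulN1r.
Qed.

Lemma msmoothB (f g : M -> R) : msmooth f -> msmooth g ->
  msmooth (fun x => f x - g x).
Proof. by move=> sf sg; apply: msmoothD sf (msmoothN sg). Qed.

Variable B : vbundle M r.
Implicit Types (X Y : vsection B) (x : M).

Lemma smooth_sectionD X Y : smooth_section X -> smooth_section Y ->
  smooth_section (fun y => X y + Y y).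
Proof.
move=> sX sY i k; have oV := vdom_open i.
apply: msmooth_on_ext oV _ (msmooth_onD oV (sX i k) (sY i k)) => y _.
by rewrite linearD.
Qed.

Lemma smooth_sectionZ (f : M -> R) X : msmooth f -> smooth_section X ->
  smooth_section (fun y => f y *: X y).
Proof.
move=> sf sX i k; have oV := vdom_open i.
have sf' : msmooth_on (vdom i) f by exact: msmooth_onS sf.
apply: msmooth_on_ext oV _ (msmooth_onM oV sf' (sX i k)) => y _.
by rewrite linearZ.
Qed.

Lemma smooth_section0 : smooth_section (fun y => 0 : B y).
Proof.
move=> i k; have oV := vdom_open i.
apply: msmooth_on_ext oV _ (msmooth_on_cst 0 oV) => y _.
by rewrite linear0.
Qed.

Lemma smooth_sectionN X : smooth_section X -> smooth_section (fun y => - X y).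
Proof.
move=> sX; have := smooth_sectionZ (msmooth_cst (-1)) sX.
by congr smooth_section; apply/functional_extensionality_dep => y; rewrite scaleN1r.
Qed.

Lemma smooth_section_sum (I : Type) (s : seq I) (F : I -> vsection B) :
  (forall i, smooth_section (F i)) ->
  smooth_section (fun y => \sum_(i <- s) F i y).
Proof.
move=> sF; elim: s => [|a s IHs].
  have := smooth_section0; congr smooth_section.
  by apply/functional_extensionality_dep => y; rewrite big_nil.
have := smooth_sectionD (sF a) IHs; congr smooth_section.
by apply/functional_extensionality_dep => y; rewrite big_cons.
Qed.

Lemma frame_expand i x (v : B x) : vdom i x ->
  v = \sum_(k < r) coord (vframe i x) k v *: tnth (vframe i x) k.
Proof.
move=> ix; rewrite {1}(coord_basis (vframe_basis ix) (memvf v)).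
by apply: eq_bigr => k _; rewrite -tnth_nth.
Qed.

Lemma smooth_frame (i : vindex B) x chi (k : 'I_r) : is_bump (vdom i) x chi ->
  smooth_section (fun y => chi y *: tnth (vframe i y) k).
Proof.
move=> bchi j l.
have [_ _ [W [oW WU W0]]] := bchi.
apply: msmooth_on_local => y jy.
have : (W `|` vdom i) y by rewrite WU.
case=> [Wy|iy].
  exists W => //; apply: msmooth_on_ext oW _ (msmooth_on_cst 0 oW) => z Wz.
  by rewrite W0 // scale0r linear0.
have oV : open (vdom j `&` vdom i) by apply: openI; exact: vdom_open.
have sc : msmooth_on (vdom j `&` vdom i) chi.
  by case: bchi => sc _ _; exact: msmooth_onS sc.
exists (vdom j `&` vdom i); first by split.
have H := msmooth_onM oV sc (@vtransition_smooth _ _ _ _ B j i l k).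
apply: (msmooth_on_ext oV _ H).
by move=> z _; rewrite linearZ.
Qed.

(** A combination of the cut-off frame with constant coefficients is a witness, so the choice made
    by [extend] never falls back on its default. *)
Lemma extendP x (v : B x) : smooth_section (extend v) /\ extend v x = v.
Proof.
suff [X HX] : exists X : vsection B, smooth_section X /\ X x = v.
  exact: (@xgetPex _ _ [set X : vsection B | smooth_section X /\ X x = v]
    (ex_intro _ X HX)).
have [i ix] := vdom_cover B x.
have [chi bchi] := bump_exists (vdom_open i) ix.
exists (fun y => \sum_(k < r) coord (vframe i x) k v *:
                   (chi y *: tnth (vframe i y) k)); split.
  apply: smooth_section_sum => k.
  by apply: (smooth_sectionZ (msmooth_cst _)); exact: smooth_frame bchi.
rewrite [RHS](frame_expand v ix); apply: eq_bigr => k _.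
by case: bchi => _ -> _; rewrite scale1r.
Qed.

Definition extend_smooth x (v : B x) := (extendP v).1.
Definition extendE x (v : B x) := (extendP v).2.

(* With [chi] a bump function supported in the domain of a frame [e], one has
   [X = (1 - chi^2) X + sum_k (chi X^k) (chi e_k)], and all the coefficients are
   global smooth functions vanishing wherever [X] does. *)
Lemma tensorial0 x (T : vsection B -> R) X :
  (forall Y Z, smooth_section Y -> smooth_section Z ->
     T (fun y => Y y + Z y) = T Y + T Z) ->
  (forall f Y, msmooth f -> smooth_section Y ->
     T (fun y => f y *: Y y) = f x * T Y) ->
  smooth_section X -> X x = 0 -> T X = 0.
Proof.
move=> TD TZ sX X0.
have [i ix] := vdom_cover B x.
have [chi bchi] := bump_exists (vdom_open i) ix.
pose c k y := chi y * coord (vframe i y) k (X y).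
have sc k : msmooth (c k) := msmooth_onbump (vdom_open i) bchi (sX i k).
pose E k : vsection B := fun y => chi y *: tnth (vframe i y) k.
have sE k : smooth_section (E k) := smooth_frame k bchi.
pose g y := 1 - chi y * chi y.
have schi : msmooth chi by case: bchi.
have sg : msmooth g.
  by apply: msmoothB; [exact: msmooth_cst|exact: msmoothM].
have -> : X = fun y => g y *: X y + \sum_(k < r) c k y *: E k y.
  apply/functional_extensionality_dep => y; rewrite /g scalerBl scale1r.
  have [chi0|chi0] := eqVneq (chi y) 0.
    rewrite chi0 mul0r scale0r subr0 big1 ?addr0 // => k _.
    by rewrite /c chi0 mul0r scale0r.
  have iy := bump_subset bchi chi0.
  rewrite [X in _ + X](_ : _ = (chi y * chi y) *: X y) ?subrK //.
  rewrite [X in _ = _ *: X](frame_expand _ iy) scaler_sumr.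
  by apply: eq_bigr => k _; rewrite /c /E !scalerA mulrAC.
have T0 : T (fun y => 0) = 0.
  have := TZ _ _ (msmooth_cst 0) smooth_section0; rewrite mul0r => <-.
  by congr T; apply/functional_extensionality_dep => y; rewrite scale0r.
have sG k := smooth_sectionZ (sc k) (sE k).
rewrite (TD _ _ (smooth_sectionZ sg sX) (smooth_section_sum _ sG)).
have -> : T (fun y => \sum_(k < r) c k y *: E k y) = 0.
  elim: (index_enum _) => [|a s IHs].
    rewrite -T0; congr T; apply/functional_extensionality_dep => y.
    by rewrite big_nil.
  rewrite (_ : (fun y => _) =
    fun y => c a y *: E a y + \sum_(k <- s) c k y *: E k y); last first.
    by apply/functional_extensionality_dep => y; rewrite big_cons.
  rewrite (TD _ _ (sG a) (smooth_section_sum s sG)) IHs addr0.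
  by rewrite (TZ _ _ (sc a) (sE a)) /c X0 linear0 mulr0 mul0r.
by rewrite (TZ _ _ sg sX) /g; case: bchi => _ -> _; rewrite mulr1 subrr mul0r addr0.
Qed.

Lemma tensorial x (T : vsection B -> R) X Y :
  (forall Y Z, smooth_section Y -> smooth_section Z ->
     T (fun y => Y y + Z y) = T Y + T Z) ->
  (forall f Y, msmooth f -> smooth_section Y ->
     T (fun y => f y *: Y y) = f x * T Y) ->
  smooth_section X -> smooth_section Y -> X x = Y x -> T X = T Y.
Proof.
move=> TD TZ sX sY XY.
have sN := smooth_sectionN sY.
have := tensorial0 TD TZ (smooth_sectionD sX sN); rewrite XY subrr => /(_ erefl).
rewrite TD // => TXY; apply/eqP; rewrite -subr_eq0 -[X in _ == X]TXY.
apply/eqP; congr (_ + _).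
rewrite -mulN1r -(TZ (fun=> -1)) //; last exact: msmooth_cst.
by congr T; apply/functional_extensionality_dep => y; rewrite scaleN1r.
Qed.

End BundleSections.

(** [linfun] is total but represents [f] only when [f] is linear. For the covectors built through
    [extend] or [bracketP] linearity is a proved fact, not a declared structure. *)
Lemma linfun_linearE (R : realType) (V : vectType R) (f : V -> R^o) v :
  linear f -> linfun f v = f v.
Proof.
move=> lf; pose h := GRing.isLinear.Build R V R^o *:%R f lf.
pose F : {linear V -> R^o} := HB.pack f h.
exact: (lfunE F v).
Qed.

(** * The pairing of a bundle with its dual *)

Section Pairing.
Variables (R : realType) (n : nat) (M : manifold R n) (r : nat).
Variable A : vbundle M r.
Implicit Types (X Y : vsection A) (a b : vsection (dual A)) (x : M).

Definition pr a X : M -> R := fun y => (a y : 'Hom(A y, R^o)) (X y).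

Lemma pr_smooth a X : smooth_section a -> smooth_section X -> msmooth (pr a X).
Proof.
move=> sa sX; apply: msmooth_on_local => x _.
have [i ix] := vdom_cover A x; exists (vdom i) => //.
have oV := vdom_open i.
apply: msmooth_on_ext oV _ (msmooth_on_sum (index_enum _) oV
  (fun k : 'I_r => msmooth_onM oV (sX i k) (sa i k))) => y iy.
rewrite /pr [in RHS](frame_expand (X y) iy) linear_sum; apply: eq_bigr => k _.
by rewrite linearZ /= dual_frame_coord.
Qed.

(** Pairing with the cut-off frame vector [chi e_k] gives [chi] times the [k]-th component of [a],
    to which [msmooth_on_bumpP] applies. *)
Lemma dual_smoothP a : (forall X, smooth_section X -> msmooth (pr a X)) ->
  smooth_section a.
Proof.
move=> H i k; have oV : open (vdom i : set M) := vdom_open i.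
apply: msmooth_on_bumpP oV _ => x chi ix bchi.
have := H _ (@smooth_frame _ _ _ _ A i x chi k bchi); congr msmooth; apply/funext => y.
have [chi0|chi0] := eqVneq (chi y) 0.
  by rewrite /pr chi0 scale0r linear0 mul0r.
by rewrite /pr linearZ /= dual_frame_coord //; exact: bump_subset bchi chi0.
Qed.

Lemma section_smoothP X : (forall a, smooth_section a -> msmooth (pr a X)) ->
  smooth_section X.
Proof.
move=> H i k; have oV : open (vdom i : set M) := vdom_open i.
apply: msmooth_on_bumpP oV _ => x chi ix bchi.
have := H _ (@smooth_frame _ _ _ _ (dual A) i x chi k bchi).
congr msmooth; apply/funext => y.
by rewrite /pr scale_lfunE dual_frameE.
Qed.

Lemma dual_sep x (u v : A x) :
  (forall b : dual A x, (b : 'Hom(A x, R^o)) u = (b : 'Hom(A x, R^o)) v) -> u = v.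
Proof.
move=> H; have [i ix] := vdom_cover A x.
rewrite (frame_expand u ix) (frame_expand v ix); apply: eq_bigr => k _.
by congr (_ *: _); have := H (tnth (dual_frame i x) k); rewrite !dual_frameE.
Qed.

Lemma prDl a b X x : pr (fun y => a y + b y) X x = pr a X x + pr b X x.
Proof. by rewrite /pr add_lfunE. Qed.

Lemma prZl (f : M -> R) a X x : pr (fun y => f y *: a y) X x = f x * pr a X x.
Proof. by rewrite /pr scale_lfunE. Qed.

Lemma prDr a X Y x : pr a (fun y => X y + Y y) x = pr a X x + pr a Y x.
Proof. by rewrite /pr linearD. Qed.

Lemma prZr (f : M -> R) a X x : pr a (fun y => f y *: X y) x = f x * pr a X x.
Proof. by rewrite /pr linearZ. Qed.

Lemma prNr a X x : pr a (fun y => - X y) x = - pr a X x.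
Proof. by rewrite /pr linearN. Qed.

End Pairing.

(** * Exterior algebra in one fibre *)

Section AlternatingMaps.
Variables (R : realType) (V : lmodType R).
Implicit Types (w h : seq V -> R) (s t : seq V) (u v : V).

Definition homog k w := forall s, size s != k -> w s = 0.

Definition mlin w := forall s1 s2 (a : R) u v,
  w (s1 ++ (a *: u + v) :: s2) = a * w (s1 ++ u :: s2) + w (s1 ++ v :: s2).

Definition altern w := forall s1 s2 s3 u, w (s1 ++ u :: s2 ++ u :: s3) = 0.

(** For [k = 0] the predecessor is again [0], harmlessly: the contraction then vanishes
    identically. *)
Lemma homog_cons k w v : homog k w -> homog k.-1 (fun s => w (v :: s)).
Proof. by case: k => [|k] hw s hs; rewrite hw. Qed.

Lemma mlin_cons w v : mlin w -> mlin (fun s => w (v :: s)).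
Proof. by move=> lw s1 s2 a u u'; rewrite -!cat_cons lw. Qed.

Lemma altern_cons w v : altern w -> altern (fun s => w (v :: s)).
Proof. by move=> lw s1 s2 s3 u; rewrite -!cat_cons lw. Qed.

Lemma mlinD w s1 s2 u v : mlin w ->
  w (s1 ++ (u + v) :: s2) = w (s1 ++ u :: s2) + w (s1 ++ v :: s2).
Proof. by move=> lw; rewrite -[u in LHS]scale1r lw mul1r. Qed.

Lemma mlin0 w s1 s2 : mlin w -> w (s1 ++ 0 :: s2) = 0.
Proof.
move=> lw; have := lw s1 s2 (-1) 0 0.
by rewrite scaler0 addr0 mulN1r addNr.
Qed.

Lemma mlinZ w s1 s2 (a : R) u : mlin w ->
  w (s1 ++ (a *: u) :: s2) = a * w (s1 ++ u :: s2).
Proof. by move=> lw; rewrite -[a *: u]addr0 lw mlin0 // addr0. Qed.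

Lemma mlin_sum (I : Type) (r : seq I) w s1 s2 (F : I -> V) : mlin w ->
  w (s1 ++ (\sum_(i <- r) F i) :: s2) = \sum_(i <- r) w (s1 ++ F i :: s2).
Proof.
move=> lw; elim: r => [|i r IHr]; first by rewrite !big_nil mlin0.
by rewrite !big_cons mlinD // IHr.
Qed.

Lemma alt_swap w s1 s2 u v : mlin w -> altern w ->
  w (s1 ++ u :: v :: s2) = - w (s1 ++ v :: u :: s2).
Proof.
move=> lw aw; apply/eqP; rewrite -addr_eq0; apply/eqP.
have := aw s1 [::] s2 (u + v); rewrite /= mlinD //.
rewrite -!(cat_rcons _ s1 (_ :: s2)) !mlinD // !cat_rcons.
have := aw s1 [::] s2 u; have /= -> := aw s1 [::] s2 v; move=> /= ->.
by rewrite add0r addr0.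
Qed.

Lemma alt_move w s1 s2 u : mlin w -> altern w ->
  w (s1 ++ u :: s2) = (-1) ^+ size s1 * w (u :: s1 ++ s2).
Proof.
elim: s1 w => [|a s1 IHs] w lw aw; first by rewrite expr0 mul1r.
rewrite cat_cons (IHs (fun s => w (a :: s))); last 2 first.
- exact: mlin_cons.
- exact: altern_cons.
by rewrite -[a :: _]cat0s alt_swap //= exprS mulN1r mulrN mulNr.
Qed.

(** The fibrewise content of [wedge], convertible to it. Over a bare module the factors can be
    replaced by their contractions in recursions on the argument list. *)
Definition fwedge w h s : R :=
  \sum_(m : (size s).-tuple bool)
    (-1) ^+ (\sum_(i < size s) \sum_(j < size s | (j < i)%N)
               (tnth m i && ~~ tnth m j)) *
    (w (mask m s) * h (mask (map negb m) s)).

Lemma fwedge_nil w h : fwedge w h [::] = w [::] * h [::].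
Proof.
rewrite /fwedge (bigD1 [tuple]) //= big_ord0 expr0 mul1r big1 ?addr0 // => m.
by case/eqP; exact: tuple0.
Qed.

Lemma fwedgel w w' h s : (forall t, w t = w' t) -> fwedge w h s = fwedge w' h s.
Proof. by move=> E; apply: eq_bigr => m _; rewrite E. Qed.

Lemma fwedger w h h' s : (forall t, h t = h' t) -> fwedge w h s = fwedge w h' s.
Proof. by move=> E; apply: eq_bigr => m _; rewrite E. Qed.

Lemma fwedge_linr w h h' (a : R) s :
  fwedge w (fun t => a * h t + h' t) s = a * fwedge w h s + fwedge w h' s.
Proof.
rewrite /fwedge mulr_sumr -big_split; apply: eq_bigr => m _ /=.
by ring.
Qed.

Lemma fwedge0l h s : fwedge (fun=> 0) h s = 0.
Proof. by apply: big1 => m _; rewrite mul0r mulr0. Qed.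

Lemma fwedge0r w s : fwedge w (fun=> 0) s = 0.
Proof. by apply: big1 => m _; rewrite !mulr0. Qed.

Lemma fwedgeZr w h (a : R) s : fwedge w (fun t => a * h t) s = a * fwedge w h s.
Proof.
rewrite -[RHS]addr0 -(fwedge0r w s) -fwedge_linr.
by apply: fwedger => t; rewrite addr0.
Qed.

Lemma fwedgeNr w h s : fwedge w (fun t => - h t) s = - fwedge w h s.
Proof.
rewrite -mulN1r -fwedgeZr; apply: fwedger => t; by rewrite mulN1r.
Qed.

(** Contraction by [v] is an antiderivation. The first bit of a mask tells which factor receives
    [v]; if it is [h], the shuffle carries [v] past the [k] arguments of [w]. *)
Lemma fwedge_cons k w h v s : homog k w ->
  fwedge w h (v :: s) =
  fwedge (fun t => w (v :: t)) h s +
  (-1) ^+ k * fwedge w (fun t => h (v :: t)) s.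
Proof.
move=> hw; rewrite {1}/fwedge /=.
pose f (p : bool * (size s).-tuple bool) : (size s).+1.-tuple bool :=
  [tuple of p.1 :: p.2].
rewrite (reindex f); last first.
  exists (fun m => (thead m, [tuple of behead m])) => [[b m] _|m _] /=.
    by rewrite theadE; congr (_, _); apply: val_inj.
  by rewrite [RHS]tuple_eta; apply: val_inj.
(* The inversions of [b :: m] are those of [m] and, if [b] is false, one more for each argument that
   [m] gives to [w]. *)
have inv b (m : (size s).-tuple bool) :
   (\sum_(i < (size s).+1) \sum_(j < (size s).+1 | (j < i)%N)
      (tnth (f (b, m)) i && ~~ tnth (f (b, m)) j) =
    (if b then 0 else size (mask m s)) +
    \sum_(i < size s) \sum_(j < size s | (j < i)%N)
      (tnth m i && ~~ tnth m j))%N.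
  rewrite big_ord_recl big1 ?add0n //.
  rewrite size_mask ?size_tuple //.
  have -> : (if b then 0 else count id m)%N =
            (\sum_(i < size s) (tnth m i && ~~ b))%N.
    case: b; first by rewrite big1 // => i _; rewrite andbF.
    rewrite -sum1_count big_tuple big_mkcond /=.
    by apply: eq_bigr => i _; rewrite andbT; case: (tnth m i).
  rewrite -big_split; apply: eq_bigr => i _ /=.
  rewrite big_mkcond big_ord_recl /= [in RHS]big_mkcond /=.
  rewrite /f /= !(tnth_nth false) /=; congr (_ + _)%N.
  by apply: eq_bigr => j _; rewrite !(tnth_nth false).
rewrite (eq_bigr (fun p : bool * (size s).-tuple bool =>
   (-1) ^+ ((if p.1 then 0 else size (mask p.2 s)) +
     \sum_(i < size s) \sum_(j < size s | (j < i)%N)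
      (tnth p.2 i && ~~ tnth p.2 j))%N *
   (w (mask (p.1 :: p.2) (v :: s)) *
    h (mask (~~ p.1 :: map negb p.2) (v :: s))))); last first.
  by move=> [b m] _; rewrite inv.
rewrite -(pair_bigA _ (fun (b : bool) (m : (size s).-tuple bool) =>
   (-1) ^+ ((if b then 0 else size (mask m s)) +
     \sum_(i < size s) \sum_(j < size s | (j < i)%N)
      (tnth m i && ~~ tnth m j))%N *
   (w (mask (b :: m) (v :: s)) *
    h (mask (~~ b :: map negb m) (v :: s))))) /=.
rewrite big_bool /=; congr (_ + _).
rewrite /fwedge mulr_sumr; apply: eq_bigr => m _.
(* The sign depends on how many arguments [m] selects, but masks selecting a number other than [k]
   contribute zero. *)
have [E|ne] := eqVneq (size (mask m s)) k; last first.
  by rewrite hw // mul0r !mulr0.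
by rewrite E exprD !mulrA.
Qed.

Lemma fwedge_scal w h s : homog 0 w -> fwedge w h s = w [::] * h s.
Proof.
elim: s h => [|v s IHs] h hw; first exact: fwedge_nil.
rewrite (fwedge_cons _ _ _ hw) expr0 mul1r IHs //.
rewrite (@fwedgel _ (fun=> 0)) ?fwedge0l ?add0r // => t.
by rewrite hw.
Qed.

Lemma fwedge1_nil w h : homog 1 w -> fwedge w h [::] = 0.
Proof. by move=> hw; rewrite fwedge_nil hw ?mul0r. Qed.

Lemma fwedge1_cons w h v s : homog 1 w ->
  fwedge w h (v :: s) = w [:: v] * h s - fwedge w (fun t => h (v :: t)) s.
Proof.
move=> hw; rewrite (fwedge_cons _ _ _ hw) expr1 mulN1r fwedge_scal //.
exact: (homog_cons (k := 1)).
Qed.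

Lemma fwedge1_homog k w h : homog 1 w -> homog k h -> homog k.+1 (fwedge w h).
Proof.
move=> hw hh s; elim: s k h hh => [|v s IHs] k h hh hs.
  exact: fwedge1_nil.
rewrite fwedge1_cons // [h s]hh ?mulr0 ?sub0r // -1?fwedgeNr.
case: k hh hs => [|k] hh hs.
  by rewrite (@fwedger _ _ (fun=> 0)) ?fwedge0r // => t; rewrite hh // oppr0.
rewrite fwedgeNr (IHs k) ?oppr0 //.
exact: (homog_cons (k := k.+1)).
Qed.

Lemma fwedge1_mlin w h : homog 1 w -> mlin w -> mlin h -> mlin (fwedge w h).
Proof.
move=> hw lw lh s1; elim: s1 h lh => [|a s1 IHs] h lh s2 c u v.
  rewrite !cat0s !fwedge1_cons //.
  have -> : w [:: c *: u + v] = c * w [:: u] + w [:: v] by exact: (lw [::] [::]).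
  rewrite (@fwedger _ _ (fun t => c * h (u :: t) + h (v :: t))); last first.
    by move=> t; exact: (lh [::] t).
  by rewrite fwedge_linr; ring.
rewrite !cat_cons !fwedge1_cons // lh (IHs (fun t => h (a :: t))); last first.
  exact: mlin_cons.
by ring.
Qed.

(** Among the ways to hand one argument to [w], only the one that hands over this [u] survives; in
    all others [u] is left to [h]. *)
Lemma fwedge1_move w h s1 s2 u : homog 1 w -> (forall t, u \in t -> h t = 0) ->
  fwedge w h (s1 ++ u :: s2) = (-1) ^+ size s1 * (w [:: u] * h (s1 ++ s2)).
Proof.
move=> hw; elim: s1 h => [|a s1 IHs] h hu.
  rewrite /= fwedge1_cons // (@fwedger _ _ (fun=> 0)) ?fwedge0r ?subr0 ?expr0 ?mul1r //.
  by move=> t; rewrite hu // mem_head.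
rewrite /= fwedge1_cons // [h _]hu ?mulr0 ?sub0r; last first.
  by rewrite mem_cat mem_head orbT.
rewrite (IHs (fun t => h (a :: t))); last by move=> t ut; rewrite hu // inE ut orbT.
by rewrite exprS mulN1r mulNr.
Qed.

Lemma fwedge1_altern w h : homog 1 w -> mlin h -> altern h ->
  altern (fwedge w h).
Proof.
move=> hw lh ah s1; elim: s1 h lh ah => [|a s1 IHs] h lh ah s2 s3 u.
  rewrite cat0s fwedge1_cons // (fwedge1_move (h := fun t => h (u :: t))) //.
    by rewrite alt_move //; ring.
  move=> t /splitPr[p1 p2]; exact: (ah [::]).
rewrite cat_cons fwedge1_cons // ah mulr0 IHs ?subr0 //.
  exact: mlin_cons.
exact: altern_cons.
Qed.

(* Euler's identity [sum_j e_j /\ i_(e^j) h = k h]. *)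
Lemma fwedge_euler (I : finType) (w_ : I -> seq V -> R) (a_ : I -> V) h s :
  (forall j, homog 1 (w_ j)) ->
  (forall v, \sum_j w_ j [:: v] *: a_ j = v) -> mlin h -> altern h ->
  \sum_j fwedge (w_ j) (fun t => h (a_ j :: t)) s = (size s)%:R * h s.
Proof.
move=> hw ha; elim: s h => [|v s IHs] h lh ah.
  by rewrite mul0r big1 // => j _; exact: fwedge1_nil.
under eq_bigr => j _ do rewrite fwedge1_cons //.
rewrite sumrB; have -> : \sum_j w_ j [:: v] * h (a_ j :: s) = h (v :: s).
  rewrite -{2}(ha v) -[_ :: s]cat0s mlin_sum //.
  by apply: eq_bigr => j _; rewrite mlinZ.
rewrite -sumrN (eq_bigr (fun j => fwedge (w_ j) (fun t => h (v :: a_ j :: t)) s)).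
  rewrite (IHs (fun t => h (v :: t))); last 2 first.
  - exact: mlin_cons.
  - exact: altern_cons.
  by rewrite /= -addn1 natrD; ring.
move=> j _; rewrite -fwedgeNr; apply: fwedger => t.
by rewrite -[_ :: _ :: t]cat0s alt_swap // opprK.
Qed.

Lemma fwedge11 w h a b : homog 1 w ->
  fwedge w h [:: a; b] = w [:: a] * h [:: b] - w [:: b] * h [:: a].
Proof.
move=> hw; by rewrite !fwedge1_cons // fwedge1_nil //; ring.
Qed.

Lemma fwedge12 w h a b c : homog 1 w ->
  fwedge w h [:: a; b; c] =
  w [:: a] * h [:: b; c] - w [:: b] * h [:: a; c] + w [:: c] * h [:: a; b].
Proof.
by move=> hw; rewrite !fwedge1_cons // fwedge1_nil //; ring.
Qed.

Lemma fwedge21 w h a b c : homog 2 w -> homog 1 h ->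
  fwedge w h [:: a; b; c] =
  w [:: a; b] * h [:: c] - w [:: a; c] * h [:: b] + w [:: b; c] * h [:: a].
Proof.
move=> hw hh.
have hw1 v : homog 1 (fun t => w (v :: t)) by exact: (homog_cons (k := 2)).
rewrite (fwedge_cons _ _ _ hw) fwedge11 //.
rewrite (fwedge_cons _ _ _ hw) (fwedge1_cons _ _ _ (hw1 b)) (fwedge1_nil _ (hw1 b)).
rewrite (@fwedger _ _ (fun=> 0)) ?fwedge0r; first by ring.
by move=> t; rewrite hh.
Qed.

End AlternatingMaps.

(** * Smooth forms: sums, contractions and wedge products *)

Section Forms.
Variables (R : realType) (n : nat) (M : manifold R n) (r : nat).
Variable B : vbundle M r.
Implicit Types (w h : form B) (X : vsection B) (x : M).

Lemma form_homog k w x : is_form k w -> homog k (w x).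
Proof. by case=> H _ _ _; exact: H. Qed.

Lemma form_mlin k w x : is_form k w -> mlin (w x).
Proof. by case=> _ H _ _; exact: H. Qed.

Lemma form_altern k w x : is_form k w -> altern (w x).
Proof. by case=> _ _ H _; exact: H. Qed.

Lemma form_frame k w i (I : seq 'I_r) : is_form k w ->
  msmooth_on (vdom i) (fun x => w x [seq tnth (vframe i x) l | l <- I]).
Proof. by case=> _ _ _ H; exact: H. Qed.

Lemma is_form0 k : is_form k ((fun _ _ => 0) : form B).
Proof.
split=> // [x s1 s2 a u v|i I]; first by rewrite mulr0 addr0.
by apply: msmooth_on_cst; exact: vdom_open.
Qed.

Lemma is_formD k w h : is_form k w -> is_form k h ->
  is_form k (fun x s => w x s + h x s).
Proof.
move=> Fw Fh; split=> [x s hs|x s1 s2 a u v|x s1 s2 s3 u|i I].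
- by rewrite (form_homog Fw) // (form_homog Fh) // addr0.
- by rewrite (form_mlin Fw) (form_mlin Fh); ring.
- by rewrite (form_altern Fw) (form_altern Fh) addr0.
- exact: (msmooth_onD (vdom_open i) (form_frame I Fw) (form_frame I Fh)).
Qed.

Lemma is_formM k (f : M -> R) w : msmooth f -> is_form k w ->
  is_form k (fun x s => f x * w x s).
Proof.
move=> sf Fw; split=> [x s hs|x s1 s2 a u v|x s1 s2 s3 u|i I].
- by rewrite (form_homog Fw) // mulr0.
- by rewrite (form_mlin Fw); ring.
- by rewrite (form_altern Fw) mulr0.
- have sf' : msmooth_on (vdom i) f by exact: msmooth_onS sf.
  exact: (msmooth_onM (vdom_open i) sf' (form_frame I Fw)).
Qed.

Lemma is_form_sum k (I : Type) (s : seq I) (F : I -> form B) :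
  (forall i, is_form k (F i)) -> is_form k (fun x t => \sum_(i <- s) F i x t).
Proof.
move=> sF; elim: s => [|a s IHs].
  have := is_form0 k; congr is_form.
  by apply/functional_extensionality_dep => x; apply/funext => t; rewrite big_nil.
have := is_formD (sF a) IHs; congr is_form.
by apply/functional_extensionality_dep => x; apply/funext => t; rewrite big_cons.
Qed.

Lemma is_form_contract k w X : is_form k w -> smooth_section X ->
  is_form k.-1 (contract X w).
Proof.
move=> Fw sX; split=> [x|x|x|i I].
- exact: homog_cons (form_homog (x := x) Fw).
- exact: mlin_cons (form_mlin (x := x) Fw).
- exact: altern_cons (form_altern (x := x) Fw).
have oV := vdom_open i.
have S := msmooth_on_sum (index_enum 'I_r) oV
  (fun l => msmooth_onM oV (sX i l) (form_frame (l :: I) Fw)).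
apply: (msmooth_on_ext oV _ S) => y iy.
rewrite /contract {2}(frame_expand (X y) iy) -[_ :: _]cat0s.
rewrite (mlin_sum _ _ _ _ (form_mlin (x := y) Fw)); apply: eq_bigr => l _.
by rewrite (mlinZ _ _ _ _ (form_mlin (x := y) Fw)).
Qed.

Fixpoint smooth_all (Xs : seq (vsection B)) : Prop :=
  if Xs is X :: Xs' then smooth_section X /\ smooth_all Xs' else True.

Lemma smooth_all_nth Xs i : smooth_all Xs ->
  smooth_section (nth (fun y => 0 : B y) Xs i).
Proof.
elim: Xs i => [|X Xs IHs] i.
  by move=> _; rewrite nth_nil; exact: smooth_section0.
by case: i => [|i] /= [sX sXs]; [exact: sX|exact: IHs].
Qed.

Lemma smooth_all_remove Xs i : smooth_all Xs -> smooth_all (remove_nth i Xs).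
Proof.
elim: Xs i => [|X Xs IHs] [|i] //= [sX sXs]; first by rewrite /remove_nth /= drop0.
by split=> //; exact: IHs.
Qed.

Lemma smooth_all_extend x (s : seq (B x)) : smooth_all [seq extend v | v <- s].
Proof. by elim: s => //= v s IHs; split=> //; exact: extend_smooth. Qed.

Lemma form0_smooth w : is_form 0 w -> msmooth (fun x => w x [::]).
Proof.
move=> Fw; apply: msmooth_on_local => x _; have [i ix] := vdom_cover B x.
by exists (vdom i) => //; exact: (form_frame [::] Fw).
Qed.

Lemma eval_smooth k w Xs : is_form k w -> smooth_all Xs ->
  msmooth (eval_form w Xs).
Proof.
elim: Xs k w => [|X Xs IHs] k w Fw /=.
  case: k Fw => [|k] Fw _; first exact: form0_smooth.
  have := @msmooth_cst R n M 0; congr msmooth; apply/funext => x.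
  by rewrite /eval_form (form_homog Fw).
by case=> sX sXs; exact: (IHs _ _ (is_form_contract Fw sX) sXs).
Qed.

Lemma is_form_fun (f : M -> R) : msmooth f -> is_form 0 (form_of_fun B f).
Proof.
move=> sf; split=> [x []//|x [|? ?] s2 a u v|x [|? ?] s2 s3 u|i [|j I]] //=;
  try by rewrite mulr0 addr0.
  by apply: msmooth_onS sf.
by apply: msmooth_on_cst; exact: vdom_open.
Qed.

Lemma form0_funE w : is_form 0 w -> w = form_of_fun B (fun x => w x [::]).
Proof.
move=> Fw; apply/functional_extensionality_dep => x; apply/funext => -[|v s] //=.
by rewrite (form_homog Fw).
Qed.

Lemma is_form1 (th : forall x, B x -> R) :
  (forall x (a : R) u v, th x (a *: u + v) = a * th x u + th x v) ->
  (forall i l, msmooth_on (vdom i) (fun x => th x (tnth (vframe i x) l))) ->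
  is_form 1 ((fun x s => if s is [:: v] then th x v else 0) : form B).
Proof.
move=> lth sth; split=> [x [|u [|v s]]//|x s1 s2 a u v|x s1 s2 s3 u|i [|j [|l I]]] /=.
- case: s1 => [|v1 [|v2 s1]] /=; try by rewrite mulr0 addr0.
  by case: s2 => [|v2 s2]; [exact: lth|rewrite mulr0 addr0].
- by case: s1 => [|v1 [|v2 s1]] //=; case: s2.
- by apply: msmooth_on_cst; exact: vdom_open.
- exact: sth.
- by apply: msmooth_on_cst; exact: vdom_open.
Qed.

Lemma wedgeE w h x s : wedge w h x s = fwedge (w x) (h x) s.
Proof. by []. Qed.

Lemma wedge_fun (f : M -> R) h x s : wedge (form_of_fun B f) h x s = f x * h x s.
Proof. by rewrite wedgeE fwedge_scal // => -[]. Qed.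

Lemma is_form_wedge1 k w h : is_form 1 w -> is_form k h ->
  is_form k.+1 (wedge w h).
Proof.
move=> Fw Fh; split=> [x|x|x|i I].
- exact: fwedge1_homog (form_homog Fw) (form_homog Fh).
- exact: fwedge1_mlin (form_homog Fw) (form_mlin Fw) (form_mlin Fh).
- exact: fwedge1_altern (form_homog Fw) (form_mlin Fh) (form_altern Fh).
have oV := vdom_open i.
(* Contraction with a vector of a local frame leads out of the smooth global forms, so the induction
   retains only the smoothness of [h] on frames. *)
have : forall J, msmooth_on (vdom i)
  (fun x => h x [seq tnth (vframe i x) l | l <- J]).
  by move=> J; exact: (form_frame J Fh).
elim: I (h) => [|l I IHI] h' sh'.
  apply: (msmooth_on_ext oV _ (msmooth_on_cst 0 oV)) => x _.
  by rewrite wedgeE fwedge1_nil //; exact: form_homog Fw.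
have H1 := msmooth_onM oV (form_frame [:: l] Fw) (sh' I).
have H2 := IHI (fun x t => h' x (tnth (vframe i x) l :: t)) (fun J => sh' (l :: J)).
have H3 := msmooth_onD oV H1 (msmooth_onM oV (msmooth_on_cst (-1) oV) H2).
apply: (msmooth_on_ext oV _ H3) => x _ /=.
by rewrite !wedgeE [RHS]fwedge1_cons ?mulN1r //; exact: form_homog Fw.
Qed.

End Forms.

(** * Reduction of identities between multivectors to wedge products *)

Section MultivectorInduction.
Variables (R : realType) (n : nat) (M : manifold R n) (r : nat).
Variable A : vbundle M r.

Lemma is_form_covector (a : vsection (dual A)) : smooth_section a ->
  is_form 1 (form_of_covector a).
Proof.
move=> sa; apply: (@is_form1 _ _ _ _ A (fun x v => (a x : 'Hom(A x, R^o)) v)).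
  by move=> x c u v; rewrite linearP.
move=> i l; have oV := vdom_open i.
apply: (msmooth_on_ext oV _ (sa i l)) => x ix.
by rewrite dual_frame_coord.
Qed.

Lemma is_form_vector (X : vsection A) : smooth_section X ->
  is_multivector A 1 (mvec_of_vector X).
Proof.
move=> sX.
apply: (@is_form1 _ _ _ _ (dual A) (fun x b => (b : 'Hom(A x, R^o)) (X x))).
  by move=> x c u v; rewrite add_lfunE scale_lfunE.
move=> i l; have oV : open (vdom i : set M) := vdom_open i.
by apply: (msmooth_on_ext oV _ (sX i l)) => x ix; rewrite dual_frameE.
Qed.

(** By Euler's identity a multiple of [Q] by a function nonzero at [x] is a sum of products
    [Y /\ Q'] with global factors. With [E] the difference of the two sides of an identity, the
    identity needs to be checked only on such products. *)
Lemma euler_ind x k (E : multivector A -> R) Q :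
  (forall Q Q', is_multivector A k.+1 Q -> is_multivector A k.+1 Q' ->
     E (fun y t => Q y t + Q' y t) = E Q + E Q') ->
  (forall f Q, msmooth f -> is_multivector A k.+1 Q ->
     E (fun y t => f y * Q y t) = f x * E Q) ->
  (forall Y Q', smooth_section Y -> is_multivector A k Q' ->
     E (wedge (mvec_of_vector Y) Q') = 0) ->
  is_multivector A k.+1 Q -> E Q = 0.
Proof.
move=> ED EZ EW FQ; have [i ix] := vdom_cover A x.
have [chi bchi] := bump_exists (vdom_open i) ix.
pose e l : vsection A := fun y => chi y *: tnth (vframe i y) l.
pose e' l : vsection (dual A) := fun y => chi y *: tnth (dual_frame i y) l.
have se l : smooth_section (e l) := smooth_frame l bchi.
have se' l : smooth_section (e' l) := @smooth_frame _ _ _ _ (dual A) i x chi l bchi.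
have schi : msmooth chi by case: bchi.
(* Frame and coframe are both cut off, whence [chi^2]; at [x] the value is [k + 1], which is
   invertible. *)
pose f y := k.+1%:R * (chi y * chi y).
have sf : msmooth f := msmoothM (@msmooth_cst _ _ M _) (msmoothM schi schi).
have FW l : is_multivector A k.+1 (wedge (mvec_of_vector (e l)) (contract (e' l) Q)).
  exact: is_form_wedge1 (is_form_vector (se l)) (is_form_contract FQ (se' l)).
have EQ : (fun y t => f y * Q y t) =
  fun y t => \sum_(l < r) wedge (mvec_of_vector (e l)) (contract (e' l) Q) y t.
  apply/functional_extensionality_dep => y; apply/funext => t.
  have [ht|ht] := eqVneq (size t) k.+1; last first.
    rewrite (form_homog FQ) // mulr0 big1 // => l _.
    by rewrite (form_homog (FW l)).
  rewrite /f; have [chi0|chi0] := eqVneq (chi y) 0.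
    rewrite chi0 !(mul0r, mulr0) big1 // => l _; rewrite wedgeE.
    rewrite (@fwedger _ _ _ _ (fun=> 0)) ?fwedge0r // => s.
    rewrite /contract /e' chi0 scale0r -[_ :: _]cat0s.
    by rewrite mlin0 //; exact: form_mlin FQ.
  have iy := bump_subset bchi chi0.
  (* Where [chi] does not vanish, the system dual to [chi e_l] is [chi^-1 e^l]; passing from it to
     [chi e^l] produces the factor [chi^2]. *)
  have := @fwedge_euler _ _ _ (fun l => mvec_of_vector (e l) y)
    (fun l => (chi y)^-1 *: tnth (dual_frame i y) l) (Q y) t.
  rewrite ht => eu.
  have {}eu := eu _ _ (form_mlin FQ) (form_altern FQ).
  rewrite -mulrA mulrCA -eu; first last.
  - move=> v; rewrite [RHS](dual_frame_expand v iy); apply: eq_bigr => l _.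
    have -> : mvec_of_vector (e l) y [:: v] =
        chi y * (v : 'Hom(A y, R^o)) (tnth (vframe i y) l).
      exact: linearZ.
    by rewrite scalerA mulrAC divff // mul1r !(tnth_nth 0).
  - by move=> l; exact: form_homog (is_form_vector (se l)).
  rewrite mulr_sumr; apply: eq_bigr => l _; rewrite wedgeE -fwedgeZr.
  apply: fwedger => s; rewrite /contract /e'.
  have QZ c u : Q y ((c *: u) :: s) = c * Q y (u :: s).
    exact: (mlinZ [::] s c u (form_mlin FQ)).
  by rewrite !QZ mulrA mulfK.
have E0 : E (fun y t => f y * Q y t) = 0.
  rewrite EQ; elim: (index_enum _) => [|l s IHs].
    have F0 := is_form0 (dual A) k.+1.
    rewrite (_ : (fun y t => _) = fun y t => 0 * 0); last first.
      apply/functional_extensionality_dep => y; apply/funext => t.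
      by rewrite big_nil mulr0.
    by rewrite (EZ (fun=> 0) _ (@msmooth_cst _ _ M 0) F0) mul0r.
  rewrite (_ : (fun y t => _) = fun y t =>
     wedge (mvec_of_vector (e l)) (contract (e' l) Q) y t +
     \sum_(j <- s) wedge (mvec_of_vector (e j)) (contract (e' j) Q) y t);
    last first.
    apply/functional_extensionality_dep => y; apply/funext => t.
    by rewrite big_cons.
  rewrite (ED _ _ (FW l) (is_form_sum s FW)) IHs addr0.
  exact: EW (se l) (is_form_contract FQ (se' l)).
move: E0; rewrite (EZ _ _ sf FQ) /f; case: bchi => _ -> _.
rewrite !mulr1 => /eqP; rewrite mulf_eq0 pnatr_eq0 /= => /eqP ->.
by [].
Qed.

End MultivectorInduction.

Lemma sum_ord_gt0 (R : zmodType) m (F : 'I_m.+1 -> R) :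
  \sum_(j < m.+1 | (@ord0 m < j)%N) F j = \sum_(j < m) F (lift ord0 j).
Proof. by rewrite big_mkcond big_ord_recl /= add0r. Qed.

Lemma sum_ord_gtS (R : zmodType) m (i : 'I_m) (F : 'I_m.+1 -> R) :
  \sum_(j < m.+1 | (lift ord0 i < j)%N) F j =
  \sum_(j < m | (i < j)%N) F (lift ord0 j).
Proof. by rewrite big_mkcond big_ord_recl /= add0r [in RHS]big_mkcond. Qed.

(** * Consequences of the algebroid axioms and the Koszul formula *)

Section AlgebroidCalculus.
Variables (R : realType) (n : nat) (M : manifold R n) (r : nat).
Variables (B : vbundle M r) (L : algebroid_data B).
Hypothesis hL : is_lie_algebroid L.
Implicit Types (X Y Z : vsection B) (f g : M -> R) (w h : form B) (x : M).

Lemma br_smooth X Y : smooth_section X -> smooth_section Y ->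
  smooth_section (abracket L X Y).
Proof. by case: hL => -[H _] _ _ _ _; exact: H. Qed.

Lemma br_anti X Y x : smooth_section X -> smooth_section Y ->
  abracket L X Y x = - abracket L Y X x.
Proof. by move=> sX sY; case: hL => _ [H _] _ _ _; exact: H. Qed.

Lemma br_jacobi X Y Z x : smooth_section X -> smooth_section Y ->
  smooth_section Z ->
  abracket L (abracket L X Y) Z x + abracket L (abracket L Y Z) X x +
  abracket L (abracket L Z X) Y x = 0.
Proof. by move=> sX sY sZ; case: hL => _ [_ H] _ _ _; exact: H. Qed.

Lemma rho_smooth X f : smooth_section X -> msmooth f ->
  msmooth (anchor_field L X f).
Proof. by case: hL => _ _ [_ _ H] _ _; exact: H. Qed.

Lemma rho_br X Y f x : smooth_section X -> smooth_section Y -> msmooth f ->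
  anchor_field L (abracket L X Y) f x =
  anchor_field L X (anchor_field L Y f) x -
  anchor_field L Y (anchor_field L X f) x.
Proof. by move=> sX sY sf; case: hL => _ _ _ H _; exact: H. Qed.

Lemma brZr f X Y x : msmooth f -> smooth_section X -> smooth_section Y ->
  abracket L X (fun y => f y *: Y y) x =
  f x *: abracket L X Y x + anchor_field L X f x *: Y x.
Proof. by move=> sf sX sY; case: hL => _ _ _ _ H; exact: H. Qed.

Lemma brDl X Y Z x : smooth_section X -> smooth_section Y ->
  smooth_section Z ->
  abracket L (fun y => X y + Y y) Z x = abracket L X Z x + abracket L Y Z x.
Proof.
move=> sX sY sZ; case: hL => -[_ H] _ _ _ _.
rewrite -[abracket L X Z x]scale1r -(H 1 X Y Z sX sY sZ x); congr (abracket L _ Z x).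
by apply/functional_extensionality_dep => y; rewrite scale1r.
Qed.

Lemma brDr X Y Z x : smooth_section X -> smooth_section Y ->
  smooth_section Z ->
  abracket L X (fun y => Y y + Z y) x = abracket L X Y x + abracket L X Z x.
Proof.
move=> sX sY sZ; rewrite (br_anti x sX (smooth_sectionD sY sZ)) brDl //.
by rewrite (br_anti x sX sY) (br_anti x sX sZ) opprD.
Qed.

Lemma brZl f X Y x : msmooth f -> smooth_section X -> smooth_section Y ->
  abracket L (fun y => f y *: X y) Y x =
  f x *: abracket L X Y x - anchor_field L Y f x *: X x.
Proof.
move=> sf sX sY; rewrite (br_anti x (smooth_sectionZ sf sX) sY) brZr //.
by rewrite (br_anti x sX sY) scalerN opprD.
Qed.

Lemma anchor_tv x (v : B x) : is_tangent_vector x (anchor L v).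
Proof. by case: hL => _ _ [H _ _] _ _; exact: H. Qed.

Lemma anchor_lin x (a : R) (u v : B x) f : msmooth f ->
  anchor L (a *: u + v) f = a * anchor L u f + anchor L v f.
Proof. by move=> sf; case: hL => _ _ [_ H _] _ _; exact: H. Qed.

Lemma rhoD X f g x : msmooth f -> msmooth g ->
  anchor_field L X (fun y => f y + g y) x =
  anchor_field L X f x + anchor_field L X g x.
Proof.
move=> sf sg; rewrite /anchor_field; have [H _] := anchor_tv (X x).
rewrite -[anchor L (X x) f]mul1r -(H 1 f g sf sg); congr (anchor L _ _).
by apply/funext => y; rewrite mul1r.
Qed.

Lemma rhoM X f g x : msmooth f -> msmooth g ->
  anchor_field L X (fun y => f y * g y) x =
  anchor_field L X f x * g x + f x * anchor_field L X g x.
Proof. by move=> sf sg; have [_ H] := anchor_tv (X x); exact: H. Qed.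

Lemma rho0 X x : anchor_field L X (fun=> 0) x = 0.
Proof.
have := rhoD X x (@msmooth_cst R n M 0) (@msmooth_cst R n M 0).
rewrite (_ : (fun _ : M => 0 + 0) = fun=> 0); last by apply/funext => y; rewrite addr0.
by move=> /eqP; rewrite -subr_eq0 opprD addrA subrr add0r oppr_eq0 => /eqP.
Qed.

Lemma rho_cst X (a : R) x : anchor_field L X (fun=> a) x = 0.
Proof.
have s1 := @msmooth_cst R n M 1; have := rhoM X x s1 s1.
rewrite (_ : (fun _ : M => 1 * 1) = fun=> 1); last by apply/funext => y; rewrite mulr1.
rewrite mulr1 mul1r => E.
have E1 : anchor_field L X (fun=> 1) x = 0.
  by move/eqP: E; rewrite -subr_eq0 opprD addrA subrr add0r oppr_eq0 => /eqP.
have [H _] := anchor_tv (X x).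
have := H a (fun=> 1) (fun=> 0) s1 (@msmooth_cst R n M 0).
rewrite (_ : (fun _ : M => a * 1 + 0) = fun=> a); last first.
  by apply/funext => y; rewrite mulr1 addr0.
by rewrite -![anchor L (X x) _]/(anchor_field L X _ x) => ->; rewrite E1 rho0 mulr0 addr0.
Qed.

Lemma rhoN X f x : msmooth f ->
  anchor_field L X (fun y => - f y) x = - anchor_field L X f x.
Proof.
move=> sf; rewrite -mulN1r.
rewrite (_ : (fun y => - f y) = fun y => -1 * f y); last first.
  by apply/funext => y; rewrite mulN1r.
by rewrite (rhoM X x (@msmooth_cst R n M (-1)) sf) rho_cst mul0r add0r.
Qed.

Lemma rhoB X f g x : msmooth f -> msmooth g ->
  anchor_field L X (fun y => f y - g y) x =
  anchor_field L X f x - anchor_field L X g x.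
Proof. by move=> sf sg; rewrite (rhoD X x sf (msmoothN sg)) rhoN. Qed.

Lemma rhoDl X Y f x : msmooth f ->
  anchor_field L (fun y => X y + Y y) f x =
  anchor_field L X f x + anchor_field L Y f x.
Proof.
move=> sf; rewrite /anchor_field -[X x]scale1r (anchor_lin _ _ _ sf).
by rewrite scale1r mul1r.
Qed.

Lemma anchorZ x (a : R) (v : B x) f : msmooth f ->
  anchor L (a *: v) f = a * anchor L v f.
Proof.
move=> sf; have := anchor_lin 1 (0 : B x) 0 sf.
rewrite scaler0 addr0 mul1r => /eqP; rewrite -subr_eq0 opprD addrA subrr add0r.
rewrite oppr_eq0 => /eqP E0.
by rewrite -[a *: v]addr0 (anchor_lin _ _ _ sf) E0 addr0.
Qed.

Lemma rhoZl g X f x : msmooth f ->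
  anchor_field L (fun y => g y *: X y) f x = g x * anchor_field L X f x.
Proof. by move=> sf; rewrite /anchor_field anchorZ. Qed.

Lemma rhoNl X f x : msmooth f ->
  anchor_field L (fun y => - X y) f x = - anchor_field L X f x.
Proof.
move=> sf; rewrite -mulN1r -(rhoZl (fun=> -1)) //; congr (anchor_field L _ f x).
by apply/functional_extensionality_dep => y; rewrite scaleN1r.
Qed.

Lemma size_remove_nth (T : Type) i (s : seq T) : (i < size s)%N ->
  size (remove_nth i s) = (size s).-1.
Proof.
move=> h; rewrite size_cat size_take size_drop h; lia.
Qed.

Lemma koszul_homog k w Xs x : is_form k w -> size Xs != k.+1 ->
  koszul L w Xs x = 0.
Proof.
move=> Fw hs.
have E0 (Ys : seq (vsection B)) : size Ys != k -> eval_form w Ys = fun=> 0.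
  by move=> h; apply/funext => y; rewrite /eval_form (form_homog Fw) ?size_map.
rewrite /koszul big1 ?add0r => [|i _]; last first.
  rewrite E0 ?rho0 ?mulr0 // size_remove_nth //.
  by apply: contraNneq hs => <-; rewrite prednK //; case: (size Xs) i => [[]|].
apply: big1 => i _; apply: big1 => j ij.
have hj := ltn_ord j.
rewrite E0 ?mulr0 //= size_remove_nth ?size_remove_nth //; last by lia.
by apply: contraNneq hs => <-; apply/eqP; lia.
Qed.

Lemma koszulE w Xs x : koszul L w Xs x =
    \sum_(i < size Xs) (-1) ^+ i * anchor_field L (nth (fun y => 0 : B y) Xs i)
       (eval_form w (remove_nth i Xs)) x +
    \sum_(i < size Xs) \sum_(j < size Xs | (i < j)%N)
      (-1) ^+ (i + j) *
      eval_form w (abracket L (nth (fun y => 0 : B y) Xs i)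
                              (nth (fun y => 0 : B y) Xs j) ::
                   remove_nth i (remove_nth j Xs)) x.
Proof. by []. Qed.

(** Cartan's formula [i_X d = L_X - d i_X], the first two terms being [L_X w] on [Xs]. It isolates
    the dependence on the first argument. *)
Lemma koszul_cons k w X Xs x : is_form k w ->
  koszul L w (X :: Xs) x =
  anchor_field L X (eval_form w Xs) x -
  \sum_(j < size Xs) (-1) ^+ j *
     eval_form w (abracket L X (nth (fun y => 0 : B y) Xs j) ::
                  remove_nth j Xs) x -
  koszul L (contract X w) Xs x.
Proof.
move=> Fw; have r0 (T : Type) (t : T) s : remove_nth 0 (t :: s) = s.
  by rewrite /remove_nth /= drop0.
rewrite !koszulE /= big_ord_recl /= expr0 mul1r r0.
rewrite [X in _ + X = _]big_ord_recl sum_ord_gt0.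
rewrite -!addrA; congr (_ + _); rewrite addrCA -sumrN; congr (_ + _).
  apply: eq_bigr => j _; rewrite /= add0n exprS mulN1r mulNr; congr (- (_ * _)).
by rewrite /bump /= add1n (r0 _ X (remove_nth j Xs)).
rewrite opprD -!sumrN; congr (_ + _); apply: eq_bigr => i _.
  by rewrite /bump /= add1n exprS mulN1r mulNr.
rewrite sum_ord_gtS -sumrN; apply: eq_bigr => j _.
rewrite /= /bump /= !add1n.
rewrite addSn addnS !exprS !mulN1r opprK -mulrN; congr (_ * _).
exact: (alt_swap [::] _ _ _ (form_mlin Fw) (form_altern Fw)).
Qed.

Lemma koszulD k w h Xs x : is_form k w -> is_form k h -> smooth_all Xs ->
  koszul L (fun y t => w y t + h y t) Xs x = koszul L w Xs x + koszul L h Xs x.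
Proof.
move=> Fw Fh sXs; rewrite !koszulE addrACA; congr (_ + _); rewrite -big_split.
  apply: eq_bigr => i _; rewrite /= -mulrDr; congr (_ * _).
  by apply: rhoD; [apply: eval_smooth Fw _|apply: eval_smooth Fh _];
     exact: smooth_all_remove.
apply: eq_bigr => i _; rewrite /= -big_split; apply: eq_bigr => j _.
by rewrite /= -mulrDr.
Qed.

(** The last sum is [df /\ w]: among the terms of the Koszul formula only those with the anchor
    differentiate [f]. *)
Lemma koszulM k f w Xs x : msmooth f -> is_form k w -> smooth_all Xs ->
  koszul L (fun y t => f y * w y t) Xs x =
  f x * koszul L w Xs x +
  \sum_(i < size Xs) (-1) ^+ i *
    (anchor_field L (nth (fun y => 0 : B y) Xs i) f x *
     eval_form w (remove_nth i Xs) x).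
Proof.
move=> sf Fw sXs; rewrite !koszulE mulrDr addrAC; congr (_ + _).
  rewrite mulr_sumr -big_split; apply: eq_bigr => i _ /=.
  have := rhoM (nth (fun y => 0 : B y) Xs i) x sf
    (eval_smooth Fw (smooth_all_remove i sXs)) => /= ->; ring.
rewrite mulr_sumr; apply: eq_bigr => i _.
by rewrite mulr_sumr; apply: eq_bigr => j _; rewrite mulrCA.
Qed.

(** When [X] is multiplied by [f], the derivatives [rho(X_j)(f)] coming from the brackets cancel
    those that [koszulM] produces in [d i_X w]. *)
Lemma koszul_tensorial k w X Y Xs x : is_form k w -> smooth_all Xs ->
  smooth_section X -> smooth_section Y -> X x = Y x ->
  koszul L w (X :: Xs) x = koszul L w (Y :: Xs) x.
Proof.
move=> Fw sXs sX sY XY.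
have wD u v (t : seq (B x)) : w x ((u + v) :: t) = w x (u :: t) + w x (v :: t).
  exact: (mlinD [::] t u v (form_mlin Fw)).
have wZ a v (t : seq (B x)) : w x ((a *: v) :: t) = a * w x (v :: t).
  exact: (mlinZ [::] t a v (form_mlin Fw)).
apply: (tensorial (T := fun X => koszul L w (X :: Xs) x)) sX sY XY
  => [Y1 Y2 s1 s2|f Y1 sf s1] /=.
  have -> : (koszul L w ((fun y => Y1 y + Y2 y) :: Xs) x) =
    anchor_field L Y1 (eval_form w Xs) x + anchor_field L Y2 (eval_form w Xs) x
    - (\sum_(j < size Xs) (-1) ^+ j *
         eval_form w (abracket L Y1 (nth (fun y => 0 : B y) Xs j) ::
                  remove_nth j Xs) x
     + \sum_(j < size Xs) (-1) ^+ j *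
         eval_form w (abracket L Y2 (nth (fun y => 0 : B y) Xs j) ::
                  remove_nth j Xs) x)
    - (koszul L (contract Y1 w) Xs x + koszul L (contract Y2 w) Xs x).
    rewrite (koszul_cons _ _ _ Fw) rhoDl; last exact: eval_smooth Fw sXs.
    congr (_ - _ - _).
      rewrite -big_split; apply: eq_bigr => j _ /=; rewrite -mulrDr /eval_form /=.
      by rewrite (brDl _ s1 s2 (smooth_all_nth j sXs)) wD.
    rewrite -(koszulD _ (is_form_contract Fw s1) (is_form_contract Fw s2)) //.
    congr (koszul L _ Xs x); apply/functional_extensionality_dep => y.
    apply/funext => t; rewrite /contract.
    exact: (mlinD [::] t _ _ (form_mlin Fw)).
  by rewrite !(koszul_cons _ _ _ Fw); ring.
rewrite (koszul_cons _ _ _ Fw) rhoZl; last exact: eval_smooth Fw sXs.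
have -> : koszul L (contract (fun y => f y *: Y1 y) w) Xs x =
  koszul L (fun y t => f y * contract Y1 w y t) Xs x.
  congr (koszul L _ Xs x); apply/functional_extensionality_dep => y.
  apply/funext => t; rewrite /contract.
  exact: (mlinZ [::] t _ _ (form_mlin Fw)).
rewrite (koszulM _ sf (is_form_contract Fw s1) sXs) (koszul_cons _ _ _ Fw).
rewrite (eq_bigr (fun j : 'I_(size Xs) => f x * ((-1) ^+ j *
     eval_form w (abracket L Y1 (nth (fun y => 0 : B y) Xs j) ::
                  remove_nth j Xs) x) -
   (-1) ^+ j *
    (anchor_field L (nth (fun y => 0 : B y) Xs j) f x *
     eval_form (contract Y1 w) (remove_nth j Xs) x))).
  by rewrite sumrB -mulr_sumr; ring.
move=> j _; rewrite /eval_form /= (brZl _ sf s1 (smooth_all_nth j sXs)).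
rewrite wD -scaleNr !wZ /contract.
by rewrite mulrDr mulNr mulrN mulrCA.
Qed.

Lemma koszul1 w X Y x : koszul L w [:: X; Y] x =
  anchor_field L X (eval_form w [:: Y]) x - anchor_field L Y (eval_form w [:: X]) x
  - w x [:: abracket L X Y x].
Proof.
rewrite koszulE [size _]/= 2!big_ord_recl !big_ord0.
rewrite 2!big_ord_recl !big_ord0 sum_ord_gtS !sum_ord_gt0 big_ord1 big_ord0.
rewrite /= /bump /= !addn0 !expr0 !expr1 /eval_form /=; ring.
Qed.

Lemma diff_form1 w X Y x : is_form 1 w -> smooth_section X -> smooth_section Y ->
  diff_form L w x [:: X x; Y x] =
  anchor_field L X (eval_form w [:: Y]) x - anchor_field L Y (eval_form w [:: X]) x
  - w x [:: abracket L X Y x].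
Proof.
move=> Fw sX sY; rewrite -koszul1.
(* Tensoriality is known in the first slot; antisymmetry brings the second argument there and
   back. *)
have kN Z Z' : smooth_section Z -> smooth_section Z' ->
    koszul L w [:: Z; Z'] x = - koszul L w [:: Z'; Z] x.
  move=> sZ sZ'; rewrite !koszul1 (br_anti x sZ sZ').
  have -> : w x [:: - abracket L Z' Z x] = - w x [:: abracket L Z' Z x].
    have := mlinZ [::] [::] (-1) (abracket L Z' Z x) (form_mlin (x := x) Fw).
    by rewrite scaleN1r mulN1r.
  by ring.
have sXe := extend_smooth (X x); have sYe := extend_smooth (Y x).
rewrite /diff_form /= (koszul_tensorial Fw _ sXe sX (extendE _)) //=.
rewrite (kN _ _ sX sYe) (koszul_tensorial Fw _ sYe sY (extendE _)) //=.
by rewrite -kN.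
Qed.

Lemma diff_form0 f X x : msmooth f -> smooth_section X ->
  diff_form L (form_of_fun B f) x [:: X x] = anchor_field L X f x.
Proof.
move=> sf sX; rewrite /diff_form /= (koszul_cons _ _ _ (is_form_fun B sf)) /=.
rewrite big_ord0 subr0 koszulE !big_ord0 addr0 subr0.
by rewrite /anchor_field extendE.
Qed.

Lemma diff_form_homog k w x s : is_form k w -> size s != k.+1 ->
  diff_form L w x s = 0.
Proof. by move=> Fw hs; apply: koszul_homog Fw _; rewrite size_map. Qed.

End AlgebroidCalculus.

(** * Differentials of functions and Lie derivatives of covectors *)

Section CartanCalculus.
Variables (R : realType) (n : nat) (M : manifold R n) (r : nat).
Variables (A : vbundle M r) (L : algebroid_data A).
Hypothesis hL : is_lie_algebroid L.
Implicit Types (X Y Z : vsection A) (a b c : vsection (dual A)) (f : M -> R).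

(** Makes covectors out of functionals on sections: [df] and [L_X a] are defined on [extend v], and
    tensoriality lets them be evaluated on any smooth section. *)
Lemma tensor_linfun x (T : vsection A -> R) Y :
  (forall Y Z, smooth_section Y -> smooth_section Z ->
     T (fun y => Y y + Z y) = T Y + T Z) ->
  (forall f Y, msmooth f -> smooth_section Y ->
     T (fun y => f y *: Y y) = f x * T Y) ->
  smooth_section Y ->
  (linfun (fun v : A x => T (extend v) : R^o) : 'Hom(A x, R^o)) (Y x) = T Y.
Proof.
move=> TD TZ sY; rewrite linfun_linearE.
  exact: tensorial TD TZ (extend_smooth _) sY (extendE _).
move=> k u v; rewrite /=; have su := extend_smooth u; have sv := extend_smooth v.
have sk := smooth_sectionZ (@msmooth_cst R n M k) su.
rewrite (tensorial TD TZ (extend_smooth _) (smooth_sectionD sk sv)).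
  by rewrite (TD _ _ sk sv) (TZ _ _ (@msmooth_cst R n M k) su).
by rewrite !extendE.
Qed.

Definition dfun f : vsection (dual A) :=
  fun x => linfun (fun v : A x => anchor_field L (extend v) f x : R^o).

Lemma dfunE f Y x : msmooth f -> smooth_section Y ->
  pr (dfun f) Y x = anchor_field L Y f x.
Proof.
move=> sf sY.
apply: (tensor_linfun (T := fun Y => anchor_field L Y f x)) sY => [Y1 Y2 _ _|g Y1 _ _].
  exact: rhoDl.
exact: rhoZl.
Qed.

Definition lied X a : vsection (dual A) :=
  fun x => linfun (fun v : A x =>
    anchor_field L X (pr a (extend v)) x - pr a (abracket L X (extend v)) x : R^o).

Lemma prDr_fun a X Y : pr a (fun y => X y + Y y) = fun y => pr a X y + pr a Y y.
Proof. by apply/funext => y; exact: prDr. Qed.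

Lemma prZr_fun a f X : pr a (fun y => f y *: X y) = fun y => f y * pr a X y.
Proof. by apply/funext => y; exact: prZr. Qed.

Lemma liedE X a Y x : smooth_section X -> smooth_section a -> smooth_section Y ->
  pr (lied X a) Y x =
  anchor_field L X (pr a Y) x - pr a (abracket L X Y) x.
Proof.
move=> sX sa sY; apply: (tensor_linfun (T := fun Y =>
  anchor_field L X (pr a Y) x - pr a (abracket L X Y) x)) sY
  => [Y1 Y2 s1 s2|f Y1 sf s1].
  rewrite prDr_fun (rhoD hL _ _ (pr_smooth sa s1) (pr_smooth sa s2)).
  by rewrite /pr (brDr hL _ sX s1 s2) linearD; ring.
rewrite prZr_fun (rhoM hL _ _ sf (pr_smooth sa s1)).
rewrite /pr (brZr hL _ sf sX s1) linearD !linearZ /=.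
rewrite -![_ *: _]/(_ * _); ring.
Qed.

Lemma lied_smooth X a : smooth_section X -> smooth_section a ->
  smooth_section (lied X a).
Proof.
move=> sX sa; apply: dual_smoothP => Y sY.
rewrite (_ : pr _ _ = fun x =>
  anchor_field L X (pr a Y) x - pr a (abracket L X Y) x).
  apply: msmoothB; first exact: rho_smooth (pr_smooth sa sY).
  exact: pr_smooth sa (br_smooth hL sX sY).
by apply/funext => x; exact: liedE.
Qed.

Lemma dual_ext x (u v : dual A x) :
  (forall Y, smooth_section Y ->
    (u : 'Hom(A x, R^o)) (Y x) = (v : 'Hom(A x, R^o)) (Y x)) -> u = v.
Proof.
by move=> H; apply/lfunP => w; have := H _ (extend_smooth w); rewrite extendE.
Qed.

Lemma pr_br_jacobi a X Y Z x : smooth_section X -> smooth_section Y ->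
  smooth_section Z ->
  pr a (abracket L (abracket L X Y) Z) x =
  pr a (abracket L X (abracket L Y Z)) x - pr a (abracket L Y (abracket L X Z)) x.
Proof.
move=> sX sY sZ; have := br_jacobi hL x sX sY sZ.
rewrite (br_anti hL x (br_smooth hL sY sZ) sX).
have -> : abracket L (abracket L Z X) Y x = abracket L Y (abracket L X Z) x.
  rewrite (br_anti hL x (br_smooth hL sZ sX) sY).
  have -> : abracket L Z X = fun y => -1 *: abracket L X Z y.
    apply/functional_extensionality_dep => y.
    by rewrite scaleN1r (br_anti hL y sZ sX).
  rewrite (brZr hL x (@msmooth_cst R n M (-1)) sY (br_smooth hL sX sZ)).
  by rewrite rho_cst // scale0r addr0 scaleN1r opprK.
rewrite addrAC => /eqP; rewrite subr_eq0 /pr => /eqP <-.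
by rewrite linearD addrK.
Qed.

Lemma lied_br X Y a : smooth_section X -> smooth_section Y -> smooth_section a ->
  lied (abracket L X Y) a = fun x => lied X (lied Y a) x - lied Y (lied X a) x.
Proof.
move=> sX sY sa; apply/functional_extensionality_dep => x.
apply: dual_ext => Z sZ; rewrite add_lfunE opp_lfunE.
rewrite -![(_ : 'Hom(A x, R^o)) (Z x)]/(pr _ Z x).
have sXY := br_smooth hL sX sY.
have sXZ := br_smooth hL sX sZ; have sYZ := br_smooth hL sY sZ.
have sXa := lied_smooth sX sa; have sYa := lied_smooth sY sa.
rewrite (liedE x sXY sa sZ) (liedE x sX sYa sZ) (liedE x sY sXa sZ).
rewrite (liedE x sY sa sXZ) (liedE x sX sa sYZ).
have -> : pr (lied Y a) Z = fun x => anchor_field L Y (pr a Z) x - pr a (abracket L Y Z) x.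
  by apply/funext => y; exact: liedE.
have -> : pr (lied X a) Z = fun x => anchor_field L X (pr a Z) x - pr a (abracket L X Z) x.
  by apply/funext => y; exact: liedE.
rewrite (rhoB hL X x (rho_smooth hL sY (pr_smooth sa sZ)) (pr_smooth sa sYZ)).
rewrite (rhoB hL Y x (rho_smooth hL sX (pr_smooth sa sZ)) (pr_smooth sa sXZ)).
rewrite (rho_br hL x sX sY (pr_smooth sa sZ)) pr_br_jacobi //.
by ring.
Qed.

End CartanCalculus.

(** * Values of the Schouten bracket with vectors and functions *)

Section SchoutenCalculus.
Variables (R : realType) (n : nat) (M : manifold R n) (r : nat).
Variables (A : vbundle M r) (L : algebroid_data A).
Variable S : multivector A -> multivector A -> multivector A.
Arguments S : clear implicits.
Hypotheses (hL : is_lie_algebroid L) (hS : is_schouten L S).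
Implicit Types (X Y Z : vsection A) (a b c : vsection (dual A)) (f : M -> R).
Implicit Types (P Q : multivector A).

Notation mv := mvec_of_vector.
Notation ff := (form_of_fun (dual A)).

Lemma form_ext P Q : (forall x s, P x s = Q x s) -> P = Q.
Proof. by move=> H; apply/functional_extensionality_dep => x; apply/funext. Qed.

Lemma S_form k l m P Q : is_multivector A k P -> is_multivector A l Q ->
  (k + l = m.+1)%N -> is_multivector A m (S P Q).
Proof. by move=> FP FQ E; case: hS => -[H _] _ _ _ _; exact: (H _ _ _ _ _ FP FQ E). Qed.

Lemma S_fun_fun f g : msmooth f -> msmooth g -> S (ff f) (ff g) = fun _ _ => 0.
Proof.
move=> sf sg; apply: form_ext => x s; case: hS => -[_ H] _ _ _ _.
exact: (H _ _ (is_form_fun _ sf) (is_form_fun _ sg)).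
Qed.

Lemma S_linr (t : R) k l P Q Q' : is_multivector A k P ->
  is_multivector A l Q -> is_multivector A l Q' ->
  S P (fun y s => t * Q y s + Q' y s) = fun x s => t * S P Q x s + S P Q' x s.
Proof.
move=> FP FQ FQ'; apply: form_ext => x s; case: hS => _ [_ H] _ _ _.
exact: (H _ _ _ _ _ _ FP FQ FQ').
Qed.

Lemma S_addr k l P Q Q' : is_multivector A k P ->
  is_multivector A l Q -> is_multivector A l Q' ->
  S P (fun y s => Q y s + Q' y s) = fun x s => S P Q x s + S P Q' x s.
Proof.
move=> FP FQ FQ'.
rewrite (_ : (fun y s => Q y s + Q' y s) = fun y s => 1 * Q y s + Q' y s).
  by rewrite (S_linr 1 FP FQ FQ'); apply: form_ext => x s; rewrite mul1r.
by apply: form_ext => x s; rewrite mul1r.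
Qed.

Lemma S_vec X Y : smooth_section X -> smooth_section Y ->
  S (mv X) (mv Y) = mv (abracket L X Y).
Proof.
move=> sX sY; apply: form_ext => x s; case: hS => _ _ [H _] _ _.
exact: (H _ _ sX sY).
Qed.

Lemma S_vec_fun X f : smooth_section X -> msmooth f ->
  S (mv X) (ff f) = ff (anchor_field L X f).
Proof.
move=> sX sf; apply: form_ext => x s; case: hS => _ _ [_ H] _ _.
exact: (H _ _ sX sf).
Qed.

Lemma S_comm k l P Q : is_multivector A k P -> is_multivector A l Q ->
  S P Q = fun x s => (-1) ^+ (k * l) * S Q P x s.
Proof.
move=> FP FQ; apply: form_ext => x s; case: hS => _ _ _ H _.
exact: (H _ _ _ _ FP FQ).
Qed.

Lemma S_wedge k k' k'' P Q Q' : is_multivector A k P ->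
  is_multivector A k' Q -> is_multivector A k'' Q' ->
  S P (wedge Q Q') = fun x s =>
    wedge (S P Q) Q' x s + (-1) ^+ (k' * k.+1) * wedge Q (S P Q') x s.
Proof.
move=> FP FQ FQ'; apply: form_ext => x s; case: hS => _ _ _ _ H.
exact: (H _ _ _ _ _ _ FP FQ FQ').
Qed.

Lemma mulf_wedge f Q : (fun x s => f x * Q x s) = wedge (ff f) Q.
Proof. by apply: form_ext => x s; rewrite wedge_fun. Qed.

Lemma S_mulf k l f P Q : msmooth f -> is_multivector A k P ->
  is_multivector A l Q ->
  S P (fun x s => f x * Q x s) =
  fun x s => wedge (S P (ff f)) Q x s + f x * S P Q x s.
Proof.
move=> sf FP FQ; rewrite mulf_wedge (S_wedge FP (is_form_fun _ sf) FQ).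
by apply: form_ext => x s; rewrite mul0n expr0 mul1r wedge_fun.
Qed.

Lemma S_vec_mulf l f X Q : msmooth f -> smooth_section X ->
  is_multivector A l Q ->
  S (mv X) (fun x s => f x * Q x s) =
  fun x s => anchor_field L X f x * Q x s + f x * S (mv X) Q x s.
Proof.
move=> sf sX FQ; rewrite (S_mulf sf (is_form_vector sX) FQ) S_vec_fun //.
by apply: form_ext => x s; rewrite wedge_fun.
Qed.

Lemma S_vec_wedge l X Y Q : smooth_section X -> smooth_section Y ->
  is_multivector A l Q ->
  S (mv X) (wedge (mv Y) Q) =
  fun x s => wedge (mv (abracket L X Y)) Q x s + wedge (mv Y) (S (mv X) Q) x s.
Proof.
move=> sX sY FQ.
rewrite (S_wedge (is_form_vector sX) (is_form_vector sY) FQ) (S_vec sX sY).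
by apply: form_ext => x s; rewrite -signr_odd /= expr0 mul1r.
Qed.

Lemma mv_homog X x : homog 1 (mv X x).
Proof. by case=> [|? [|? ?]]. Qed.

Lemma is_form_wedge_contract k Y a Q : smooth_section Y -> smooth_section a ->
  is_multivector A k Q ->
  is_multivector A k (wedge (mv Y) (contract a Q)).
Proof.
move=> sY sa; case: k => [|k] FQ; last first.
  exact: is_form_wedge1 (is_form_vector sY) (is_form_contract FQ sa).
have := is_form0 (dual A) 0; congr (is_form 0); apply: form_ext => x s.
rewrite wedgeE (@fwedger _ _ _ _ (fun=> 0)) ?fwedge0r // => t.
by rewrite /contract (form_homog FQ).
Qed.

(* [[L_X, i_a] = i_(L_X a)], checked on wedge products [Y /\ Q']. *)
Lemma S_contract k X a Q x s : smooth_section X -> smooth_section a ->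
  is_multivector A k Q ->
  S (mv X) Q x (a x :: s) = S (mv X) (contract a Q) x s - Q x (lied L X a x :: s).
Proof.
move=> sX sa; have FX := is_form_vector sX.
elim: k Q s => [|k IHk] Q s FQ.
  have SF : is_multivector A 0 (S (mv X) Q) := S_form FX FQ erefl.
  rewrite (form_homog SF) // (form_homog FQ) // subr0.
  rewrite (_ : contract a Q = fun y t => 0 * 0); last first.
    by apply: form_ext => y t; rewrite mulr0 /contract (form_homog FQ).
  rewrite (S_vec_mulf (@msmooth_cst R n M 0) sX (is_form0 (dual A) 0)).
  by rewrite mulr0 mul0r addr0.
apply/eqP; rewrite -subr_eq0; apply/eqP.
pose E Q := S (mv X) Q x (a x :: s) -
  (S (mv X) (contract a Q) x s - Q x (lied L X a x :: s)).
apply: (@euler_ind _ _ _ _ _ x k E) FQ => [Q1 Q2 F1 F2|f Q1 sf F1|Y Q1 sY F1];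
  rewrite /E.
- rewrite (S_addr FX F1 F2) /=.
  have := S_addr FX (is_form_contract F1 sa) (is_form_contract F2 sa).
  rewrite -[fun y s => _]/(contract a (fun y t => Q1 y t + Q2 y t)) => ->.
  by ring.
- rewrite (S_vec_mulf sf sX F1) /=.
  have := S_vec_mulf sf sX (is_form_contract F1 sa).
  rewrite -[fun y s => _]/(contract a (fun y t => f y * Q1 y t)) => ->.
  by rewrite /contract; ring.
have CW : contract a (wedge (mv Y) Q1) =
    fun y t => -1 * wedge (mv Y) (contract a Q1) y t + pr a Y y * Q1 y t.
  apply: form_ext => y t.
  rewrite /contract wedgeE fwedge1_cons; last exact: mv_homog.
  by rewrite addrC mulN1r.
have sp := pr_smooth sa sY.
rewrite CW (S_linr (-1) FX (is_form_wedge_contract sY sa F1) (is_formM sp F1)).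
rewrite (S_vec_mulf sp sX F1) (S_vec_wedge sX sY F1).
rewrite (S_vec_wedge sX sY (is_form_contract F1 sa)).
rewrite !wedgeE !fwedge1_cons; try exact: mv_homog.
rewrite -[mv (abracket L X Y) x [:: a x]]/(pr a (abracket L X Y) x).
rewrite -[mv Y x [:: lied L X a x]]/(pr (lied L X a) Y x) liedE //.
rewrite -[mv Y x [:: a x]]/(pr a Y x).
have -> : fwedge (mv Y x) (fun t => S (mv X) Q1 x (a x :: t)) s =
  fwedge (mv Y x) (S (mv X) (contract a Q1) x) s -
  fwedge (mv Y x) (fun t => Q1 x (lied L X a x :: t)) s.
  rewrite -[RHS]addrC -[X in X + _]mulN1r -fwedge_linr; apply: fwedger => t.
  by rewrite IHk // addrC mulN1r.
by rewrite /contract; ring.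
Qed.

(** Peeling off covectors with [S_contract] ends at a function, where the axioms give the anchor.
    Thus [S (mv X)] is the Lie derivative, and brackets with a vector become explicit in every
    degree. *)
Lemma S_lie k X Q as_ x : smooth_section X -> is_multivector A k Q ->
  smooth_all as_ ->
  S (mv X) Q x [seq a x | a <- as_] =
  anchor_field L X (eval_form Q as_) x -
  \sum_(j < size as_) (-1) ^+ j *
    eval_form Q (lied L X (nth (fun y => 0 : dual A y) as_ j) ::
                 remove_nth j as_) x.
Proof.
move=> sX; elim: as_ k Q => [|a as_ IHs] k Q FQ /=.
  move=> _; rewrite big_ord0 subr0; case: k FQ => [|k] FQ.
    by rewrite {1}(form0_funE FQ) (S_vec_fun sX (form0_smooth FQ)).
  have SF : is_multivector A k.+1 (S (mv X) Q) := S_form (is_form_vector sX) FQ erefl.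
  rewrite (form_homog SF) // (_ : eval_form Q [::] = fun=> 0) ?rho0 //.
  by apply/funext => y; rewrite /eval_form (form_homog FQ).
case=> sa sas; rewrite (S_contract _ sX sa FQ) (IHs _ _ (is_form_contract FQ sa) sas).
rewrite -addrA; congr (_ + _); rewrite big_ord_recl opprD expr0 mul1r addrC.
congr (- _ + _); first by rewrite /remove_nth /= drop0.
rewrite -!sumrN; apply: eq_bigr => j _.
rewrite /= /fintype.bump /= add1n exprS mulN1r mulNr opprK -mulrN.
congr (_ * _); rewrite add0n.
have /= := @alt_swap _ _ (Q x) [::] [seq b x | b <- remove_nth j as_] (a x)
 (lied L X (nth (fun y => 0 : dual A y) as_ j) x) (form_mlin FQ) (form_altern FQ).
by rewrite /eval_form /contract /= => ->; rewrite opprK.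
Qed.

(** Reflexivity of the fibre: the components of [v] are the values of [l] on the dual frame. *)
Lemma vector_repr x (l : dual A x -> R) :
  (forall (t : R) u v, l (t *: u + v) = t * l u + l v) ->
  exists v : A x, forall b : dual A x, (b : 'Hom(A x, R^o)) v = l b.
Proof.
move=> ll; have [i ix] := vdom_cover A x.
exists (\sum_(k < r) l (tnth (dual_frame i x) k) *: tnth (vframe i x) k) => b.
have l0 : l 0 = 0.
  by have := ll 1 0 0; rewrite scaler0 addr0 mul1r => /eqP;
     rewrite -subr_eq0 opprD addrA subrr add0r oppr_eq0 => /eqP.
have lsum (F : 'I_r -> R) :
    l (\sum_(k < r) F k *: tnth (dual_frame i x) k) =
    \sum_(k < r) F k * l (tnth (dual_frame i x) k).
  elim: (index_enum _) => [|k s IHs]; first by rewrite !big_nil.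
  by rewrite !big_cons ll IHs.
rewrite [in RHS](dual_frame_expand b ix) linear_sum.
rewrite (eq_bigr (fun k : 'I_r => (b : 'Hom(A x, R^o)) (vframe i x)`_k
   *: tnth (dual_frame i x) k)) ?lsum; last by move=> k _; rewrite (tnth_nth 0 (dual_frame _ _)).
by apply: eq_bigr => k _; rewrite linearZ /= mulrC (tnth_nth 0 (vframe i x)).
Qed.

(** In degree 2 [euler_ind] leaves products [Y /\ Q'] with [Q'] of degree 1; the axioms of the
    Schouten bracket apply to [Q'] once it is a vector. *)
Lemma multivector1_repr Q : is_multivector A 1 Q ->
  exists2 Z, smooth_section Z & Q = mv Z.
Proof.
move=> FQ.
have H x : exists v : A x, forall b : dual A x, (b : 'Hom(A x, R^o)) v = Q x [:: b].
  by apply: vector_repr => t u v; exact: (form_mlin (x := x) FQ [::] [::] t u v).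
pose Z : vsection A := fun x => xget 0
  [set v : A x | forall b : dual A x, (b : 'Hom(A x, R^o)) v = Q x [:: b]].
have ZE x (b : dual A x) : (b : 'Hom(A x, R^o)) (Z x) = Q x [:: b].
  rewrite /Z; have [v Hv] := H x.
  exact: (@xgetPex _ 0 [set v : A x | forall b : dual A x,
     (b : 'Hom(A x, R^o)) v = Q x [:: b]] (ex_intro _ v Hv)).
exists Z; last first.
  apply: form_ext => x [|u [|v s]]; rewrite /mv ?ZE //.
    by rewrite (form_homog FQ).
  by rewrite (form_homog FQ).
apply: section_smoothP => a sa.
have := eval_smooth FQ (conj sa I : smooth_all [:: a]).
by congr msmooth; apply/funext => x; rewrite /pr ZE.
Qed.

Lemma S_fun_vec f Y : msmooth f -> smooth_section Y ->
  S (ff f) (mv Y) = ff (anchor_field L Y f).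
Proof.
move=> sf sY; rewrite (S_comm (is_form_fun _ sf) (is_form_vector sY)).
by apply: form_ext => x s; rewrite mul0n expr0 mul1r S_vec_fun.
Qed.

(** Bracket with [f] and contraction with [df] are antiderivations of the wedge product that send a
    vector [Y] to the same function [rho(Y)(f)]. *)
Lemma S_fun2 f Q b x : msmooth f -> is_multivector A 2 Q ->
  S (ff f) Q x [:: b x] = Q x [:: dfun L f x; b x].
Proof.
move=> sf FQ; apply/eqP; rewrite -subr_eq0; apply/eqP.
have Ff := is_form_fun (dual A) sf.
apply: (@euler_ind _ _ _ _ _ x 1
  (fun Q => S (ff f) Q x [:: b x] - Q x [:: dfun L f x; b x])) FQ
  => [Q1 Q2 F1 F2|g Q1 sg F1|Y Q1 sY /multivector1_repr[Z sZ ->]].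
- by rewrite (S_addr Ff F1 F2); ring.
- rewrite (S_mulf sg Ff F1) (S_fun_fun sf sg) wedgeE fwedge0l; ring.
have FY := is_form_vector sY; have FZ := is_form_vector sZ.
rewrite (S_wedge Ff FY FZ) (S_fun_vec sf sY) (S_fun_vec sf sZ) expr1 mulN1r.
rewrite wedge_fun !wedgeE fwedge1_cons ?fwedge1_nil ?fwedge11; try exact: mv_homog.
rewrite -[mv Y x [:: dfun L f x]]/(pr (dfun L f) Y x).
rewrite -[mv Z x [:: dfun L f x]]/(pr (dfun L f) Z x) !dfunE //=.
by ring.
Qed.

End SchoutenCalculus.

(** * The Schouten bracket with a bivector *)

Section Bivector.
Variables (R : realType) (n : nat) (M : manifold R n) (r : nat).
Variables (A : vbundle M r) (L : algebroid_data A).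
Variable S : multivector A -> multivector A -> multivector A.
Arguments S : clear implicits.
Hypotheses (hL : is_lie_algebroid L) (hS : is_schouten L S).
Variable P : multivector A.
Arguments P : clear implicits.
Hypothesis hP : is_multivector A 2 P.
Implicit Types (X Y Z : vsection A) (a b c : vsection (dual A)) (f : M -> R).
Implicit Types (Q : multivector A).

Notation mv := mvec_of_vector.
Notation ff := (form_of_fun (dual A)).
Notation sh := (sharp_section P).

Lemma sharpE x (u v : dual A x) :
  (v : 'Hom(A x, R^o)) (sharp P u) = P x [:: u; v].
Proof.
have [w Hw] : exists w : A x, forall b : dual A x,
    (b : 'Hom(A x, R^o)) w = P x [:: u; b].
  by apply: vector_repr => t u1 u2; exact: (form_mlin (x := x) hP [:: u] [::] t u1 u2).
exact: (@xgetPex _ 0 [set w : A x | forall b : dual A x,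
  (b : 'Hom(A x, R^o)) w = P x [:: u; b]] (ex_intro _ w Hw)).
Qed.

Lemma biv_anti Q x (u v : dual A x) : is_multivector A 2 Q ->
  Q x [:: u; v] = - Q x [:: v; u].
Proof.
by move=> FQ; exact: (alt_swap [::] [::] u v (form_mlin (x := x) FQ) (form_altern FQ)).
Qed.

Lemma sharp_linear x (t : R) (u v : dual A x) :
  sharp P (t *: u + v) = t *: sharp P u + sharp P v.
Proof.
apply: dual_sep => b; rewrite linearD linearZ /= !sharpE.
exact: (form_mlin (x := x) hP [::] [:: b] t u v).
Qed.

Lemma eval2_smooth Q a b : is_multivector A 2 Q -> smooth_section a ->
  smooth_section b -> msmooth (eval_form Q [:: a; b]).
Proof. by move=> FQ sa sb; exact: (eval_smooth FQ (conj sa (conj sb I) : smooth_all [:: a; b])). Qed.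

Lemma pr_sh a b : pr b (sh a) = eval_form P [:: a; b].
Proof. by apply/funext => y; rewrite /pr /sharp_section sharpE. Qed.

Lemma sh_smooth a : smooth_section a -> smooth_section (sh a).
Proof.
by move=> sa; apply: section_smoothP => b sb; rewrite pr_sh; exact: eval2_smooth.
Qed.

Lemma eval2_anti Q a b : is_multivector A 2 Q ->
  eval_form Q [:: a; b] = fun y => - eval_form Q [:: b; a] y.
Proof. by move=> FQ; apply/funext => y; rewrite /eval_form /= (biv_anti _ _ FQ). Qed.

(* The bracket of 1-forms defined by [P] without the twist by a cocycle. *)
Definition koszul_bracket a b : vsection (dual A) :=
  fun x => lied L (sh a) b x - lied L (sh b) a x - dfun L (eval_form P [:: a; b]) x.

Lemma koszul_bracketE a b Y x : smooth_section a -> smooth_section b ->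
  smooth_section Y ->
  pr (koszul_bracket a b) Y x =
  anchor_field L (sh a) (pr b Y) x - pr b (abracket L (sh a) Y) x -
  (anchor_field L (sh b) (pr a Y) x - pr a (abracket L (sh b) Y) x) -
  anchor_field L Y (eval_form P [:: a; b]) x.
Proof.
move=> sa sb sY; rewrite {1}/pr !add_lfunE !opp_lfunE.
rewrite -![(_ : 'Hom(A x, R^o)) (Y x)]/(pr _ Y x).
rewrite (dfunE hL x (eval2_smooth hP sa sb) sY).
by rewrite (liedE hL x (sh_smooth sa) sb sY) (liedE hL x (sh_smooth sb) sa sY).
Qed.

Lemma S_vec_biv Y Q a b x : smooth_section Y -> is_multivector A 2 Q ->
  smooth_section a -> smooth_section b ->
  S (mv Y) Q x [:: a x; b x] =
  anchor_field L Y (eval_form Q [:: a; b]) x -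
  Q x [:: lied L Y a x; b x] - Q x [:: a x; lied L Y b x].
Proof.
move=> sY FQ sa sb.
have /= -> := S_lie hL hS x sY FQ (conj sa (conj sb I) : smooth_all [:: a; b]).
rewrite !big_ord_recl big_ord0 /eval_form /= /fintype.bump /= addn0 expr0 expr1.
by rewrite [Q x [:: a x; _]](biv_anti _ _ FQ); ring.
Qed.

(** The bracket is symmetric in degrees 2 and 1, so the left side is [L_Y P]; written this way it is
    minus the Koszul differential of [Y] for [koszul_bracket], the degree 1 case of [S_biv_biv]. *)
Lemma S_biv_vec Y a b x : smooth_section Y -> smooth_section a ->
  smooth_section b ->
  S P (mv Y) x [:: a x; b x] =
  - (anchor_field L (sh a) (pr b Y) x - anchor_field L (sh b) (pr a Y) x -
     pr (koszul_bracket a b) Y x).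
Proof.
move=> sY sa sb; rewrite (S_comm hS hP (is_form_vector sY)) -signr_odd /= expr0 mul1r.
rewrite (S_vec_biv x sY hP sa sb) (koszul_bracketE x sa sb sY).
have sa' := lied_smooth hL sY sa; have sb' := lied_smooth hL sY sb.
have -> : P x [:: lied L Y a x; b x] = - pr (lied L Y a) (sh b) x.
  by rewrite pr_sh /eval_form /= (biv_anti _ _ hP).
have -> : P x [:: a x; lied L Y b x] = pr (lied L Y b) (sh a) x.
  by rewrite pr_sh.
rewrite (liedE hL x sY sa (sh_smooth sb)) (liedE hL x sY sb (sh_smooth sa)).
rewrite !pr_sh (eval2_anti b a hP).
rewrite (rhoN hL _ _ (eval2_smooth hP sa sb)).
rewrite /pr (br_anti hL x sY (sh_smooth sb)) (br_anti hL x sY (sh_smooth sa)).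
by rewrite !linearN /=; ring.
Qed.

Lemma S_biv_fun f a x : msmooth f -> smooth_section a ->
  S P (ff f) x [:: a x] = - anchor_field L (sh a) f x.
Proof.
move=> sf sa; rewrite (S_comm hS hP (is_form_fun _ sf)) muln0 expr0 mul1r.
rewrite (S_fun2 hL hS a x sf hP) (biv_anti _ _ hP) -(dfunE hL x sf (sh_smooth sa)).
by rewrite /pr /sharp_section sharpE.
Qed.

(* [S P Q] is, up to sign, the Koszul differential of [Q] for the (not yet Lie)
   bracket [koszul_bracket] on sections of the dual. *)
Lemma S_biv_biv Q a b c x : is_multivector A 2 Q ->
  smooth_section a -> smooth_section b -> smooth_section c ->
  S P Q x [:: a x; b x; c x] =
  - (anchor_field L (sh a) (eval_form Q [:: b; c]) x -
     anchor_field L (sh b) (eval_form Q [:: a; c]) x +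
     anchor_field L (sh c) (eval_form Q [:: a; b]) x -
     Q x [:: koszul_bracket a b x; c x] + Q x [:: koszul_bracket a c x; b x] -
     Q x [:: koszul_bracket b c x; a x]).
Proof.
move=> FQ sa sb sc; apply/eqP; rewrite -subr_eq0; apply/eqP.
apply: (@euler_ind _ _ _ _ _ x 1 (fun Q => S P Q x [:: a x; b x; c x] -
  - (anchor_field L (sh a) (eval_form Q [:: b; c]) x -
     anchor_field L (sh b) (eval_form Q [:: a; c]) x +
     anchor_field L (sh c) (eval_form Q [:: a; b]) x -
     Q x [:: koszul_bracket a b x; c x] + Q x [:: koszul_bracket a c x; b x] -
     Q x [:: koszul_bracket b c x; a x]))) FQ
  => [Q1 Q2 F1 F2|f Q1 sf F1|Y Q1 sY /multivector1_repr[Z sZ ->]].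
- rewrite (S_addr hS hP F1 F2).
  have E X d e : smooth_section d -> smooth_section e ->
    anchor_field L X (eval_form (fun y t => Q1 y t + Q2 y t) [:: d; e]) x =
    anchor_field L X (eval_form Q1 [:: d; e]) x +
    anchor_field L X (eval_form Q2 [:: d; e]) x.
    by move=> sd se; exact: (rhoD hL X x (eval2_smooth F1 sd se) (eval2_smooth F2 sd se)).
  rewrite (E _ _ _ sb sc) (E _ _ _ sa sc) (E _ _ _ sa sb); ring.
- rewrite (S_mulf hS sf hP F1) wedgeE fwedge12; last first.
    exact: form_homog (S_form hS hP (is_form_fun _ sf) (erefl : (2 + 0 = 2)%N)).
  rewrite (S_biv_fun x sf sa) (S_biv_fun x sf sb) (S_biv_fun x sf sc).
  have E X d e : smooth_section d -> smooth_section e ->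
    anchor_field L X (eval_form (fun y t => f y * Q1 y t) [:: d; e]) x =
    anchor_field L X f x * Q1 x [:: d x; e x] +
    f x * anchor_field L X (eval_form Q1 [:: d; e]) x.
    by move=> sd se; exact: (rhoM hL X x sf (eval2_smooth F1 sd se)).
  rewrite (E _ _ _ sb sc) (E _ _ _ sa sc) (E _ _ _ sa sb); ring.
have FY := is_form_vector sY; have FZ := is_form_vector sZ.
rewrite (S_wedge hS hP FY FZ) -signr_odd /= expr1 mulN1r.
rewrite !wedgeE fwedge21; [|exact: form_homog (S_form hS hP FY erefl)|exact: mv_homog].
rewrite fwedge12; last exact: mv_homog.
rewrite !fwedge11; try exact: mv_homog.
have E X d e : smooth_section d -> smooth_section e ->
    anchor_field L X (eval_form (wedge (mv Y) (mv Z)) [:: d; e]) x =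
    anchor_field L X (pr d Y) x * pr e Z x + pr d Y x * anchor_field L X (pr e Z) x
    - (anchor_field L X (pr e Y) x * pr d Z x + pr e Y x * anchor_field L X (pr d Z) x).
  move=> sd se; have dY := pr_smooth sd sY; have eY := pr_smooth se sY.
  have dZ := pr_smooth sd sZ; have eZ := pr_smooth se sZ.
  rewrite -(rhoM hL X x dY eZ) -(rhoM hL X x eY dZ).
  rewrite -(rhoB hL X x (msmoothM dY eZ) (msmoothM eY dZ)).
  congr (anchor_field L X _ x); apply/funext => y.
  by rewrite /eval_form wedgeE fwedge11 //; exact: mv_homog.
rewrite (E _ _ _ sb sc) (E _ _ _ sa sc) (E _ _ _ sa sb).
rewrite (S_biv_vec x sY sa sb) (S_biv_vec x sY sa sc) (S_biv_vec x sY sb sc).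
rewrite (S_biv_vec x sZ sa sb) (S_biv_vec x sZ sa sc) (S_biv_vec x sZ sb sc).
rewrite /mv /pr; ring.
Qed.

(** Each [P([a, b], c)] in [S_biv_biv] expands to the whole cyclic sum of derivatives minus two of
    the three pairings. Their cyclic sum is three times the derivatives minus twice the pairings,
    and the derivatives already present lower 3 to 2. *)
Lemma S_self a b c x :
  smooth_section a -> smooth_section b -> smooth_section c ->
  S P P x [:: a x; b x; c x] =
  2 * (anchor_field L (sh a) (eval_form P [:: b; c]) x +
       anchor_field L (sh b) (eval_form P [:: c; a]) x +
       anchor_field L (sh c) (eval_form P [:: a; b]) x -
       pr c (abracket L (sh a) (sh b)) x - pr a (abracket L (sh b) (sh c)) x -
       pr b (abracket L (sh c) (sh a)) x).
Proof.
move=> sa sb sc; rewrite (S_biv_biv x hP sa sb sc).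
have K d e g : smooth_section d -> smooth_section e -> smooth_section g ->
  P x [:: koszul_bracket d e x; g x] = - pr (koszul_bracket d e) (sh g) x.
  by move=> _ _ _; rewrite pr_sh /eval_form /= (biv_anti _ _ hP).
rewrite (K _ _ _ sa sb sc) (K _ _ _ sa sc sb) (K _ _ _ sb sc sa).
have ha := sh_smooth sa; have hb := sh_smooth sb; have hc := sh_smooth sc.
rewrite (koszul_bracketE x sa sb hc) (koszul_bracketE x sa sc hb).
rewrite (koszul_bracketE x sb sc ha) !pr_sh.
rewrite (eval2_anti c b hP) (eval2_anti c a hP) (eval2_anti b a hP).
rewrite !(rhoN hL _ _ (eval2_smooth hP sb sc)) !(rhoN hL _ _ (eval2_smooth hP sa sc)).
rewrite !(rhoN hL _ _ (eval2_smooth hP sa sb)).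
rewrite /pr (br_anti hL x hc ha) (br_anti hL x hc hb) (br_anti hL x hb ha).
by rewrite !linearN /=; ring.
Qed.

End Bivector.

(** * The twisted bracket on covectors *)

Section TwistedBracket.
Variables (R : realType) (n : nat) (M : manifold R n) (r : nat).
Variables (A : vbundle M r) (L : algebroid_data A).
Variable S : multivector A -> multivector A -> multivector A.
Arguments S : clear implicits.
Variable phi0 : vsection (dual A).
Variable P : multivector A.
Arguments P : clear implicits.
Hypotheses (hL : is_lie_algebroid L) (hS : is_schouten L S).
Hypotheses (hphi0 : cocycle L phi0) (hP : is_multivector A 2 P).
Implicit Types (X Y Z : vsection A) (a b c : vsection (dual A)) (f : M -> R).

Notation mv := mvec_of_vector.
Notation sh := (sharp_section P).
Notation brP := (bracketP L phi0 P).
Notation rho := (anchor_field L).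
Notation Pf a b := (eval_form P [:: a; b]).

Let sphi : smooth_section phi0. Proof. by case: hphi0. Qed.

Lemma cocycleE X Y x : smooth_section X -> smooth_section Y ->
  pr phi0 (abracket L X Y) x = rho X (pr phi0 Y) x - rho Y (pr phi0 X) x.
Proof.
move=> sX sY; case: hphi0 => _ H; have := H x [:: X x; Y x].
rewrite (diff_form1 hL x (is_form_covector sphi) sX sY) => /eqP.
by rewrite subr_eq0 => /eqP ->.
Qed.

(** Of [i_X (phi0 /\ b) = phi0(X) b - b(X) phi0] the second term cancels [phi0 /\ i_X b], so the
    twist only adds [phi0(X) b]. *)
Lemma tlie_covector X b Y x : smooth_section X -> smooth_section b ->
  smooth_section Y ->
  tlie L (form_of_covector phi0) X (form_of_covector b) x [:: Y x] =
  pr (lied L X b) Y x + pr phi0 X x * pr b Y x.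
Proof.
move=> sX sb sY; rewrite (liedE hL x sX sb sY) /tlie /tdiff.
have -> : contract X (form_of_covector b) = form_of_fun A (pr b X).
  by apply/functional_extensionality_dep => y; apply/funext => -[|u s].
have h0 : homog 1 (form_of_covector phi0 x) by case=> [|? [|? ?]].
rewrite (diff_form0 L x (pr_smooth sb sX) sY) {1}/contract.
rewrite (diff_form1 hL x (is_form_covector sb) sX sY).
rewrite /contract !wedgeE !fwedge1_cons // fwedge1_nil //=.
rewrite -/(pr b _ x) -/(pr phi0 _ x).
rewrite -[eval_form (form_of_covector b) [:: Y]]/(pr b Y).
rewrite -[eval_form (form_of_covector b) [:: X]]/(pr b X).
by rewrite /pr; ring.
Qed.

Lemma tdiff_fun f Y x : msmooth f -> smooth_section Y ->
  tdiff L (form_of_covector phi0) (form_of_fun A f) x [:: Y x] =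
  pr (dfun L f) Y x + pr phi0 Y x * f x.
Proof.
move=> sf sY; rewrite /tdiff (diff_form0 L x sf sY) (dfunE hL x sf sY).
have h0 : homog 1 (form_of_covector phi0 x) by case=> [|? [|? ?]].
by rewrite wedgeE fwedge1_cons // fwedge1_nil // subr0.
Qed.

Lemma bracketP_koszul a b : smooth_section a -> smooth_section b ->
  brP a b = fun x => koszul_bracket L P a b x + pr phi0 (sh a) x *: b x
    - pr phi0 (sh b) x *: a x - Pf a b x *: phi0 x.
Proof.
move=> sa sb; apply/functional_extensionality_dep => x.
have ha := sh_smooth hP sa; have hb := sh_smooth hP sb.
set w := (X in _ = X).
(* The expression under [linfun] is not visibly linear in [v]; identifying it with the values of the
   covector [w] also supplies its linearity. *)
suff E v : (tlie L (form_of_covector phi0) (sh a) (form_of_covector b) x [:: v] -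
     tlie L (form_of_covector phi0) (sh b) (form_of_covector a) x [:: v] -
     tdiff L (form_of_covector phi0)
       (form_of_fun A (fun y => P y [:: a y; b y])) x [:: v]) =
     (w : 'Hom(A x, R^o)) v.
  apply/lfunP => v; rewrite /bracketP linfun_linearE ?E // => t u1 u2.
  by rewrite !E linearP.
have -> : v = extend v x by rewrite extendE.
have sv := extend_smooth v.
rewrite (tlie_covector x ha sb sv) (tlie_covector x hb sa sv).
rewrite -[fun y => P y _]/(Pf a b) (tdiff_fun x (eval2_smooth hP sa sb) sv).
rewrite /w /koszul_bracket !(add_lfunE, opp_lfunE, scale_lfunE) /pr.
by rewrite -![_ *: _]/(_ * _); ring.
Qed.

Lemma bracketP_pr a b Y x : smooth_section a -> smooth_section b ->
  smooth_section Y ->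
  pr (brP a b) Y x = pr (koszul_bracket L P a b) Y x +
    pr phi0 (sh a) x * pr b Y x - pr phi0 (sh b) x * pr a Y x -
    Pf a b x * pr phi0 Y x.
Proof.
move=> sa sb sY; rewrite bracketP_koszul // /pr.
by rewrite !(add_lfunE, opp_lfunE, scale_lfunE).
Qed.

(* Covariant derivative of the flat connection defined by the cocycle on the
   trivial line bundle; in these terms the twisted calculus is the usual one. *)
Definition twD X f : M -> R := fun y => rho X f y + pr phi0 X y * f y.

Lemma twD_smooth X f : smooth_section X -> msmooth f -> msmooth (twD X f).
Proof.
move=> sX sf; apply: msmoothD; first exact: (rho_smooth hL sX sf).
exact: msmoothM (pr_smooth sphi sX) sf.
Qed.

Lemma twDD X f g x : msmooth f -> msmooth g ->
  twD X (fun y => f y + g y) x = twD X f x + twD X g x.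
Proof. by move=> sf sg; rewrite /twD (rhoD hL X x sf sg); ring. Qed.

Lemma twDN X f x : msmooth f -> twD X (fun y => - f y) x = - twD X f x.
Proof. by move=> sf; rewrite /twD (rhoN hL X x sf); ring. Qed.

Lemma twDB X f g x : msmooth f -> msmooth g ->
  twD X (fun y => f y - g y) x = twD X f x - twD X g x.
Proof. by move=> sf sg; rewrite /twD (rhoB hL X x sf sg); ring. Qed.

Lemma twD_br X Y f x : smooth_section X -> smooth_section Y -> msmooth f ->
  twD (abracket L X Y) f x = twD X (twD Y f) x - twD Y (twD X f) x.
Proof.
move=> sX sY sf; rewrite /twD (rho_br hL x sX sY sf) (cocycleE x sX sY).
have pX := pr_smooth sphi sX; have pY := pr_smooth sphi sY.
rewrite (rhoD hL X x (rho_smooth hL sY sf) (msmoothM pY sf)).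
rewrite (rhoD hL Y x (rho_smooth hL sX sf) (msmoothM pX sf)).
by rewrite (rhoM hL X x pY sf) (rhoM hL Y x pX sf); ring.
Qed.

Lemma bracketPE a b Y x : smooth_section a -> smooth_section b ->
  smooth_section Y ->
  pr (brP a b) Y x =
  twD (sh a) (pr b Y) x - pr b (abracket L (sh a) Y) x -
  (twD (sh b) (pr a Y) x - pr a (abracket L (sh b) Y) x) - twD Y (Pf a b) x.
Proof.
move=> sa sb sY; rewrite (bracketP_pr x sa sb sY).
by rewrite (koszul_bracketE hL hP x sa sb sY) /twD; ring.
Qed.

Lemma bracketP_smooth a b : smooth_section a -> smooth_section b ->
  smooth_section (brP a b).
Proof.
move=> sa sb; apply: dual_smoothP => Y sY.
have ha := sh_smooth hP sa; have hb := sh_smooth hP sb.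
have H := msmoothB (msmoothB
  (msmoothB (twD_smooth ha (pr_smooth sb sY)) (pr_smooth sb (br_smooth hL ha sY)))
  (msmoothB (twD_smooth hb (pr_smooth sa sY)) (pr_smooth sa (br_smooth hL hb sY))))
  (twD_smooth sY (eval2_smooth hP sa sb)).
by move: H; congr msmooth; apply/funext => x; rewrite bracketPE.
Qed.

Lemma bracketP_anti a b x : smooth_section a -> smooth_section b ->
  brP a b x = - brP b a x.
Proof.
move=> sa sb; apply: dual_ext => Y sY; rewrite opp_lfunE.
rewrite -![(_ : 'Hom(A x, R^o)) (Y x)]/(pr _ Y x).
rewrite (bracketPE x sa sb sY) (bracketPE x sb sa sY) (eval2_anti b a hP).
by rewrite (twDN _ _ (eval2_smooth hP sa sb)); ring.
Qed.

Lemma shD a b : sh (fun y => a y + b y) = fun y => sh a y + sh b y.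
Proof.
apply/functional_extensionality_dep => y.
by rewrite /sharp_section -[a y]scale1r (sharp_linear hP) !scale1r.
Qed.

Lemma shZ f a : sh (fun y => f y *: a y) = fun y => f y *: sh a y.
Proof.
apply/functional_extensionality_dep => y; rewrite /sharp_section.
apply: dual_sep => b; rewrite linearZ /= !(sharpE hP).
exact: (mlinZ [::] [:: b] (f y) (a y) (form_mlin (x := y) hP)).
Qed.

Lemma bracketPDl a b c x : smooth_section a -> smooth_section b ->
  smooth_section c ->
  brP (fun y => a y + b y) c x = brP a c x + brP b c x.
Proof.
move=> sa sb sc; apply: dual_ext => Y sY; rewrite add_lfunE.
rewrite -![(_ : 'Hom(A x, R^o)) (Y x)]/(pr _ Y x).
have ha := sh_smooth hP sa; have hb := sh_smooth hP sb.
have hc := sh_smooth hP sc.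
rewrite (bracketPE x (smooth_sectionD sa sb) sc sY).
rewrite (bracketPE x sa sc sY) (bracketPE x sb sc sY) shD.
have -> : pr (fun y => a y + b y) Y = fun y => pr a Y y + pr b Y y.
  by apply/funext => y; exact: prDl.
have -> : Pf (fun y => a y + b y) c = fun y => Pf a c y + Pf b c y.
  apply/funext => y.
  exact: (mlinD [::] [:: c y] (a y) (b y) (form_mlin (x := y) hP)).
rewrite (twDD _ _ (pr_smooth sa sY) (pr_smooth sb sY)).
rewrite (twDD _ _ (eval2_smooth hP sa sc) (eval2_smooth hP sb sc)).
have -> : pr c (abracket L (fun y => sh a y + sh b y) Y) x =
    pr c (abracket L (sh a) Y) x + pr c (abracket L (sh b) Y) x.
  by rewrite /pr (brDl hL x ha hb sY) linearD.
rewrite /twD (rhoDl hL _ _ x (pr_smooth sc sY)) prDr prDl.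
by ring.
Qed.

(** The zeroth order part of [D] is linear over functions, so [f] is differentiated by [rho] alone.
    The two terms with [rho(Y)(f)], from [a([f #b, Y])] and from [D_Y (f P(a, b))], cancel. *)
Lemma bracketPZr f a b x : msmooth f -> smooth_section a -> smooth_section b ->
  brP a (fun y => f y *: b y) x = f x *: brP a b x + rho (sh a) f x *: b x.
Proof.
move=> sf sa sb; apply: dual_ext => Y sY; rewrite add_lfunE !scale_lfunE.
rewrite -![(_ : 'Hom(A x, R^o)) (Y x)]/(pr _ Y x) -![_ *: _]/(_ * _).
have ha := sh_smooth hP sa; have hb := sh_smooth hP sb.
have pb := pr_smooth sb sY.
rewrite (bracketPE x sa (smooth_sectionZ sf sb) sY) (bracketPE x sa sb sY) shZ.
have -> : pr (fun y => f y *: b y) Y = fun y => f y * pr b Y y.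
  by apply/funext => y; exact: prZl.
have -> : Pf a (fun y => f y *: b y) = fun y => f y * Pf a b y.
  apply/funext => y.
  exact: (mlinZ [:: a y] [::] (f y) (b y) (form_mlin (x := y) hP)).
rewrite prZl /twD (rhoM hL _ _ sf pb) (rhoM hL _ _ sf (eval2_smooth hP sa sb)).
rewrite (rhoZl hL _ _ _ (pr_smooth sa sY)) prZr.
have -> : pr a (abracket L (fun y => f y *: sh b y) Y) x =
   f x * pr a (abracket L (sh b) Y) x + rho Y f x * Pf a b x.
  rewrite {1}/pr (brZl hL x sf hb sY) linearB !linearZ /=.
  rewrite -![_ *: _]/(_ * _) -/(pr a _ x) -/(pr a (sh b) x) (pr_sh hP).
  by rewrite (eval2_anti b a hP); ring.
by ring.
Qed.

(** * The Jacobi identity from the condition on P *)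

Section PoissonCondition.
Hypothesis hPP : forall (x : M) (s : seq (dual A x)),
  tschouten S phi0 2 2 P P x s = 0.

(** For [k = k' = 2] the two corrections in [tschouten] are equal. As [i_phi0 P = - phi0 o #],
    together they add twice the cyclic sum of [phi0(#a) P(b, c)], which turns the [rho] of [S_self]
    into [D]; the common factor 2 is then cancelled. *)
Lemma twisted_jacobiator a b c x :
  smooth_section a -> smooth_section b -> smooth_section c ->
  twD (sh a) (Pf b c) x + twD (sh b) (Pf c a) x + twD (sh c) (Pf a b) x =
  pr c (abracket L (sh a) (sh b)) x + pr a (abracket L (sh b) (sh c)) x +
  pr b (abracket L (sh c) (sh a)) x.
Proof.
move=> sa sb sc; have := hPP [:: a x; b x; c x].
rewrite /tschouten (S_self hL hS hP x sa sb sc).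
have h1 : homog 1 (contract phi0 P x).
  exact: homog_cons (form_homog (x := x) hP).
have h2 : homog 2 (P x) := form_homog hP.
rewrite !wedgeE fwedge21 // fwedge12 //.
have E d : contract phi0 P x [:: d x] = - pr phi0 (sh d) x.
  by rewrite (pr_sh hP) /contract /eval_form /= (biv_anti _ _ hP).
rewrite !E /twD -signr_odd /= expr1.
rewrite -[P x [:: b x; c x]]/(Pf b c x) -[P x [:: a x; b x]]/(Pf a b x).
rewrite -[P x [:: a x; c x]]/(Pf a c x) (eval2_anti a c hP) => H.
have t2 : (2%:R : R) != 0 by rewrite pnatr_eq0.
by apply: (mulfI t2); apply/eqP; rewrite -subr_eq0 -H; apply/eqP; ring.
Qed.

(** Paired with [c], the left side is [- [a, b]_P (#c)], and [bracketPE] at [Y = #c] yields all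
    terms of [twisted_jacobiator] except [c([#a, #b])]. *)
Lemma sh_bracketP a b : smooth_section a -> smooth_section b ->
  sh (brP a b) = abracket L (sh a) (sh b).
Proof.
move=> sa sb; apply/functional_extensionality_dep => x; apply: dual_sep => w.
have -> : w = extend w x by rewrite extendE.
set c := extend w; have sc : smooth_section c := extend_smooth w.
have ha := sh_smooth hP sa; have hb := sh_smooth hP sb; have hc := sh_smooth hP sc.
rewrite /sharp_section (sharpE hP) (biv_anti _ _ hP).
rewrite -[P x _]/(Pf c (brP a b) x) -(pr_sh hP) (bracketPE x sa sb hc).
rewrite -/(pr c (abracket L (sh a) (sh b)) x).
have := twisted_jacobiator x sa sb sc; rewrite !(pr_sh hP) (eval2_anti c b hP).
rewrite (twDN _ _ (eval2_smooth hP sb sc)).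
have -> : pr b (abracket L (sh a) (sh c)) x = - pr b (abracket L (sh c) (sh a)) x.
  by rewrite /pr (br_anti hL x ha hc) linearN.
(* The goal is linear in [H]: zero is written as the difference of the two sides of [H], and what
   remains is an identity of rings. *)
by move=> H; apply/eqP; rewrite -subr_eq0 -(subrr (pr c (abracket L (sh a) (sh b)) x +
  pr a (abracket L (sh b) (sh c)) x + pr b (abracket L (sh c) (sh a)) x)) -{1}H;
  apply/eqP; ring.
Qed.

(** [sh_bracketP] removes the inner bracket under [#]. The terms are arranged so that in the cyclic
    sum everything cancels in pairs except the last line, which collects the derivatives along
    [Y]. *)
Lemma bracketP_bracketP a b c Y x : smooth_section a -> smooth_section b ->
  smooth_section c -> smooth_section Y ->
  pr (brP (brP a b) c) Y x =
  twD (sh a) (twD (sh b) (pr c Y)) x - twD (sh b) (twD (sh a) (pr c Y)) x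
  - pr c (abracket L (sh a) (abracket L (sh b) Y)) x
  + pr c (abracket L (sh b) (abracket L (sh a) Y)) x
  - (twD (sh c) (twD (sh a) (pr b Y)) x
     - twD (sh c) (pr b (abracket L (sh a) Y)) x
     - (twD (sh c) (twD (sh b) (pr a Y)) x
        - twD (sh c) (pr a (abracket L (sh b) Y)) x))
  + (twD (sh a) (pr b (abracket L (sh c) Y)) x
     - pr b (abracket L (sh a) (abracket L (sh c) Y)) x
     - (twD (sh b) (pr a (abracket L (sh c) Y)) x
        - pr a (abracket L (sh b) (abracket L (sh c) Y)) x))
  + twD Y (twD (sh c) (Pf a b)) x - twD Y (pr c (abracket L (sh a) (sh b))) x.
Proof.
move=> sa sb sc sY.
have ha := sh_smooth hP sa; have hb := sh_smooth hP sb; have hc := sh_smooth hP sc.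
have sab := bracketP_smooth sa sb.
have haY := br_smooth hL ha sY; have hbY := br_smooth hL hb sY.
have hcY := br_smooth hL hc sY.
rewrite (bracketPE x sab sc sY) (bracketPE x sa sb hcY).
rewrite -(pr_sh hP (brP a b) c) !sh_bracketP //.
rewrite (twD_br x ha hb (pr_smooth sc sY)) (twD_br x hc sY (eval2_smooth hP sa sb)).
rewrite (pr_br_jacobi hL c x ha hb sY).
have -> : pr (brP a b) Y = fun x =>
  twD (sh a) (pr b Y) x - pr b (abracket L (sh a) Y) x -
  (twD (sh b) (pr a Y) x - pr a (abracket L (sh b) Y) x) - twD Y (Pf a b) x.
  by apply/funext => y; exact: bracketPE.
have s1 := twD_smooth ha (pr_smooth sb sY); have s2 := pr_smooth sb haY.
have s3 := twD_smooth hb (pr_smooth sa sY); have s4 := pr_smooth sa hbY.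
have s5 := twD_smooth sY (eval2_smooth hP sa sb).
rewrite (twDB (sh c) x (msmoothB (msmoothB s1 s2) (msmoothB s3 s4)) s5).
rewrite (twDB (sh c) x (msmoothB s1 s2) (msmoothB s3 s4)).
rewrite (twDB (sh c) x s1 s2) (twDB (sh c) x s3 s4).
by ring.
Qed.

Lemma bracketP_jacobi a b c x : smooth_section a -> smooth_section b ->
  smooth_section c ->
  brP (brP a b) c x + brP (brP b c) a x + brP (brP c a) b x = 0.
Proof.
move=> sa sb sc; apply: dual_ext => Y sY; rewrite !add_lfunE zero_lfunE.
rewrite -![(_ : 'Hom(A x, R^o)) (Y x)]/(pr _ Y x).
rewrite (bracketP_bracketP x sa sb sc sY) (bracketP_bracketP x sb sc sa sY).
rewrite (bracketP_bracketP x sc sa sb sY).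
have ha := sh_smooth hP sa; have hb := sh_smooth hP sb; have hc := sh_smooth hP sc.
have s1 := twD_smooth ha (eval2_smooth hP sb sc).
have s2 := twD_smooth hb (eval2_smooth hP sc sa).
have s3 := twD_smooth hc (eval2_smooth hP sa sb).
have t1 := pr_smooth sc (br_smooth hL ha hb).
have t2 := pr_smooth sa (br_smooth hL hb hc).
have t3 := pr_smooth sb (br_smooth hL hc ha).
(* The surviving terms are [D_Y] of the difference of the two sides of [twisted_jacobiator], which
   holds at every point and can therefore be differentiated. *)
have E : twD Y (fun y => twD (sh a) (Pf b c) y + twD (sh b) (Pf c a) y +
    twD (sh c) (Pf a b) y) x =
  twD Y (fun y => pr c (abracket L (sh a) (sh b)) y +
    pr a (abracket L (sh b) (sh c)) y + pr b (abracket L (sh c) (sh a)) y) x.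
  by congr (twD Y _ x); apply/funext => y; exact: twisted_jacobiator.
move: E; rewrite (twDD Y x (msmoothD s1 s2) s3) (twDD Y x s1 s2).
rewrite (twDD Y x (msmoothD t1 t2) t3) (twDD Y x t1 t2) => E.
rewrite -[RHS](subrr (twD Y (pr c (abracket L (sh a) (sh b))) x +
  twD Y (pr a (abracket L (sh b) (sh c))) x +
  twD Y (pr b (abracket L (sh c) (sh a))) x)) -{1}E.
by ring.
Qed.

Lemma dataP_lie_algebroid : is_lie_algebroid (dataP L phi0 P).
Proof.
split=> /=.
- split=> [a b|t a b c sa sb sc x]; first exact: bracketP_smooth.
  have st := smooth_sectionZ (@msmooth_cst R n M t) sa.
  rewrite (bracketPDl x st sb sc) (bracketP_anti x st sc); congr (_ + _).
  rewrite (bracketPZr x (@msmooth_cst R n M t) sc sa) rho_cst // scale0r addr0.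
  by rewrite (bracketP_anti x sa sc) scalerN.
- by split=> [a b sa sb x|a b c sa sb sc x]; [exact: bracketP_anti|exact: bracketP_jacobi].
- split=> [x v|x t u v f sf|a f sa sf].
  + exact: (anchor_tv hL).
  + by rewrite (sharp_linear hP) (anchor_lin hL _ _ _ sf).
  + exact: (rho_smooth hL (sh_smooth hP sa) sf).
- move=> a b f sa sb sf x.
  rewrite -(rho_br hL x (sh_smooth hP sa) (sh_smooth hP sb) sf).
  by rewrite -(sh_bracketP sa sb).
- by move=> a b f sa sb sf x; exact: bracketPZr.
Qed.

(** * The cocycle X0 and the two compatibility conditions *)

Let Ls := dataP L phi0 P.
Let X0 : vsection A := fun x => - sharp_section P phi0 x.
Let hLs : is_lie_algebroid Ls := dataP_lie_algebroid.

Lemma X0_smooth : smooth_section X0.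
Proof. exact: smooth_sectionN (sh_smooth hP sphi). Qed.

Lemma pr_X0 a x : pr a X0 x = pr phi0 (sh a) x.
Proof. by rewrite prNr !(pr_sh hP) (eval2_anti phi0 a hP) opprK. Qed.

Lemma diff_form_vector Y a b x : smooth_section Y -> smooth_section a ->
  smooth_section b ->
  diff_form Ls (mv Y) x [:: a x; b x] =
  rho (sh a) (pr b Y) x - rho (sh b) (pr a Y) x - pr (brP a b) Y x.
Proof. by move=> sY sa sb; rewrite (diff_form1 hLs x (is_form_vector sY) sa sb). Qed.

(** By [pr_X0] the form [X0] is the pullback of [phi0] along [#], which respects brackets and
    anchors; so its differential is the pullback of that of [phi0]. *)
Lemma X0_cocycle : dual_cocycle Ls X0.
Proof.
split=> [|x s]; first exact: X0_smooth.
have [hs|hs] := eqVneq (size s) 2; last first.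
  exact: (diff_form_homog hLs (is_form_vector X0_smooth) hs).
case: s hs => [|u [|v [|]]] // _.
rewrite -[u]extendE -[v]extendE.
have sa := extend_smooth u; have sb := extend_smooth v.
rewrite (diff_form_vector x X0_smooth sa sb).
have E a : pr a X0 = pr phi0 (sh a) by apply/funext => y; exact: pr_X0.
rewrite !E (sh_bracketP sa sb).
by rewrite (cocycleE x (sh_smooth hP sa) (sh_smooth hP sb)) subrr.
Qed.

(** [X0 /\ Y] cancels the terms [phi0(#a) b(Y) - phi0(#b) a(Y)] of the twisted bracket, leaving
    [phi0(Y) P] beside the untwisted [- L_Y P]. The scalar [-1] is kept explicit for [S_linr]. *)
Lemma tdiff_vector Y : smooth_section Y ->
  tdiff Ls (mv X0) (mv Y) =
  fun x s => -1 * S (mv Y) P x s + pr phi0 Y x * P x s.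
Proof.
move=> sY; apply: form_ext => x s; rewrite /tdiff wedgeE.
have FY := is_form_vector sY.
have FX0 := is_form_vector X0_smooth.
have [hs|hs] := eqVneq (size s) 2; last first.
  rewrite (diff_form_homog hLs FY hs) (form_homog hP) //.
  rewrite (form_homog (S_form hS FY hP (erefl : (1 + 2 = 3)%N))) //.
  by rewrite (fwedge1_homog (@mv_homog _ _ _ _ A X0 x) (@mv_homog _ _ _ _ A Y x)) //; ring.
case: s hs => [|u [|v [|]]] // _.
rewrite -[u]extendE -[v]extendE; set a := extend u; set b := extend v.
have sa : smooth_section a := extend_smooth u.
have sb : smooth_section b := extend_smooth v.
rewrite (diff_form_vector x sY sa sb) (bracketP_pr x sa sb sY).
rewrite fwedge11; last exact: mv_homog.
rewrite -[mv X0 x [:: a x]]/(pr a X0 x) -[mv X0 x [:: b x]]/(pr b X0 x) !pr_X0.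
rewrite (S_comm hS FY hP) -signr_odd /= expr0 mul1r (S_biv_vec hL hS hP x sY sa sb).
rewrite -[P x [:: _; _]]/(Pf a b x) /mv /pr; ring.
Qed.

(** This case of the graded Jacobi identity is not among the axioms in [is_schouten]; it comes from
    the explicit Lie derivative and the commutation rules [rho_br] and [lied_br]. *)
Lemma S_vec_br X Y Q x s : smooth_section X -> smooth_section Y ->
  is_multivector A 2 Q ->
  S (mv (abracket L X Y)) Q x s =
  S (mv X) (S (mv Y) Q) x s - S (mv Y) (S (mv X) Q) x s.
Proof.
move=> sX sY FQ; have FX := is_form_vector sX; have FY := is_form_vector sY.
have sXY := br_smooth hL sX sY.
have FXQ : is_multivector A 2 (S (mv X) Q) := S_form hS FX FQ erefl.
have FYQ : is_multivector A 2 (S (mv Y) Q) := S_form hS FY FQ erefl.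
have [hs|hs] := eqVneq (size s) 2; last first.
  rewrite (form_homog (S_form hS (is_form_vector sXY) FQ (erefl : (1 + 2 = 3)%N))) //.
  rewrite (form_homog (S_form hS FX FYQ (erefl : (1 + 2 = 3)%N))) //.
  by rewrite (form_homog (S_form hS FY FXQ (erefl : (1 + 2 = 3)%N))) // subr0.
case: s hs => [|u [|v [|]]] // _.
rewrite -[u]extendE -[v]extendE; set a := extend u; set b := extend v.
have sa : smooth_section a := extend_smooth u.
have sb : smooth_section b := extend_smooth v.
have Xa := lied_smooth hL sX sa; have Xb := lied_smooth hL sX sb.
have Ya := lied_smooth hL sY sa; have Yb := lied_smooth hL sY sb.
have E Z : smooth_section Z -> eval_form (S (mv Z) Q) [:: a; b] = fun y =>
  rho Z (eval_form Q [:: a; b]) y - eval_form Q [:: lied L Z a; b] y -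
  eval_form Q [:: a; lied L Z b] y.
  by move=> sZ; apply/funext => y; exact: (S_vec_biv hL hS y sZ FQ sa sb).
rewrite (S_vec_biv hL hS x sXY FQ sa sb) (S_vec_biv hL hS x sX FYQ sa sb).
rewrite (S_vec_biv hL hS x sY FXQ sa sb) (E X sX) (E Y sY).
rewrite (S_vec_biv hL hS x sY FQ Xa sb) (S_vec_biv hL hS x sY FQ sa Xb).
rewrite (S_vec_biv hL hS x sX FQ Ya sb) (S_vec_biv hL hS x sX FQ sa Yb).
have qab := eval2_smooth FQ sa sb.
have qYa := eval2_smooth FQ Ya sb; have qYb := eval2_smooth FQ sa Yb.
have qXa := eval2_smooth FQ Xa sb; have qXb := eval2_smooth FQ sa Xb.
rewrite (rhoB hL X x (msmoothB (rho_smooth hL sY qab) qYa) qYb).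
rewrite (rhoB hL X x (rho_smooth hL sY qab) qYa).
rewrite (rhoB hL Y x (msmoothB (rho_smooth hL sX qab) qXa) qXb).
rewrite (rhoB hL Y x (rho_smooth hL sX qab) qXa).
rewrite (rho_br hL x sX sY qab) (lied_br hL sX sY sa) (lied_br hL sX sY sb).
have B1 (p q w : dual A x) : Q x [:: p - q; w] = Q x [:: p; w] - Q x [:: q; w].
  have := form_mlin (x := x) FQ [::] [:: w] (-1) q p.
  by rewrite /= scaleN1r addrC mulN1r addrC => ->; rewrite addrC.
have B2 (p q w : dual A x) : Q x [:: w; p - q] = Q x [:: w; p] - Q x [:: w; q].
  have := form_mlin (x := x) FQ [:: w] [::] (-1) q p.
  by rewrite /= scaleN1r addrC mulN1r addrC => ->; rewrite addrC.
rewrite B1 B2; ring.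
Qed.

Lemma tschouten_vec X Q x s :
  tschouten S phi0 1 2 (mv X) Q x s = S (mv X) Q x s - pr phi0 X x * Q x s.
Proof.
rewrite /tschouten.
have -> : wedge (contract phi0 (mv X)) Q x s = pr phi0 X x * Q x s.
  by rewrite wedgeE fwedge_scal // => -[].
by rewrite subrr mulr0 mul0r addr0; ring.
Qed.

(** After expansion [phi0(Y) L_X P + phi0(X) L_Y P] and [phi0(X) phi0(Y) P] are symmetric in [X] and
    [Y] and drop out; [cocycleE] matches the derivatives of [phi0(X)] and [phi0(Y)]. *)
Lemma tdiff_bracket X Y x s : smooth_section X -> smooth_section Y ->
  tdiff Ls (mv X0) (mv (abracket L X Y)) x s =
  tschouten S phi0 1 2 (mv X) (tdiff Ls (mv X0) (mv Y)) x s -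
  tschouten S phi0 1 2 (mv Y) (tdiff Ls (mv X0) (mv X)) x s.
Proof.
move=> sX sY; have FX := is_form_vector sX; have FY := is_form_vector sY.
have sXY := br_smooth hL sX sY.
have FXP : is_multivector A 2 (S (mv X) P) := S_form hS FX hP erefl.
have FYP : is_multivector A 2 (S (mv Y) P) := S_form hS FY hP erefl.
have pX := pr_smooth sphi sX; have pY := pr_smooth sphi sY.
rewrite !tschouten_vec !tdiff_vector //.
rewrite (S_linr hS (-1) FX FYP (is_formM pY hP)).
rewrite (S_linr hS (-1) FY FXP (is_formM pX hP)).
rewrite (S_vec_mulf hS pY sX hP) (S_vec_mulf hS pX sY hP).
by rewrite (S_vec_br s sX sY hP) (cocycleE x sX sY); ring.
Qed.

(** As [phi0] is closed, [L_(#a) phi0 = d (phi0(#a)) = - d (P(phi0, a))], which cancels the exact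
    term of the bracket. The zeroth order terms cancel likewise since [P(phi0, phi0) = 0], and only
    [L_(#phi0) a] is left. *)
Lemma bracketP_phi0 a : smooth_section a ->
  brP phi0 a = fun x => -1 *: lied L X0 a x.
Proof.
move=> sa; apply/functional_extensionality_dep => x; apply: dual_ext => Y sY.
rewrite scale_lfunE -![(_ : 'Hom(A x, R^o)) (Y x)]/(pr _ Y x) -[_ *: _]/(_ * _).
have h0 := sh_smooth hP sphi; have ha := sh_smooth hP sa.
rewrite (bracketP_pr x sphi sa sY) (koszul_bracketE hL hP x sphi sa sY).
rewrite (liedE hL x X0_smooth sa sY) (rhoNl hL _ _ (pr_smooth sa sY)).
have -> : pr a (abracket L X0 Y) x = - pr a (abracket L (sh phi0) Y) x.
  have -> : X0 = fun y => -1 *: sh phi0 y.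
    by apply/functional_extensionality_dep => y; rewrite scaleN1r.
  rewrite /pr (brZl hL x (@msmooth_cst R n M (-1)) h0 sY) rho_cst //.
  by rewrite scale0r subr0 scaleN1r linearN.
rewrite (cocycleE x ha sY) !(pr_sh hP).
have -> : Pf phi0 phi0 x = 0.
  exact: (form_altern (x := x) hP [::] [::] [::] (phi0 x)).
rewrite (eval2_anti phi0 a hP) (rhoN hL _ _ (eval2_smooth hP sa sphi)).
by ring.
Qed.

(** Every twist carries the factor [phi0(X0) = P(phi0, phi0) = 0] or cancels inside [tlie]. There
    remain the ordinary Lie derivatives of [Q] along [phi0] and [X0], opposite because both the
    anchor and the bracket of [phi0] are. *)
Lemma tlie_phi0 k Q x s : is_multivector A k Q ->
  tlie Ls (mv X0) phi0 Q x s + tschouten S phi0 1 k (mv X0) Q x s = 0.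
Proof.
move=> FQ; have FX0 := is_form_vector X0_smooth.
have p0 : pr phi0 X0 x = 0.
  rewrite pr_X0 (pr_sh hP).
  exact: (form_altern (x := x) hP [::] [::] [::] (phi0 x)).
rewrite /tschouten.
have -> : wedge (contract phi0 (mv X0)) Q x s = 0.
  rewrite wedgeE fwedge_scal; last by case.
  by rewrite -[contract _ _ _ _]/(pr phi0 X0 x) p0 mul0r.
rewrite subrr mulr0 mul0r addr0 mulr0 subr0.
rewrite /tlie /tdiff {3}/contract !wedgeE (fwedge1_cons _ _ _ (@mv_homog _ _ _ _ A X0 x)).
rewrite -[mv X0 x [:: phi0 x]]/(pr phi0 X0 x) p0 mul0r sub0r.
have sE := smooth_all_extend s.
(* [diff_form] extends the value [phi0 x] arbitrarily; the section [phi0] itself must stand in the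
   first slot before Cartan's formula is applied. *)
rewrite {2}/diff_form /= (koszul_tensorial hLs FQ sE (extend_smooth _) sphi (extendE _)).
rewrite (koszul_cons Ls phi0 _ x FQ) /diff_form.
have := S_lie hL hS x X0_smooth FQ sE.
rewrite -map_comp (eq_map (g := id)) ?map_id; last by move=> v /=; rewrite extendE.
move=> ->.
have -> : rho X0 (eval_form Q [seq extend v | v <- s]) x =
   - rho (sh phi0) (eval_form Q [seq extend v | v <- s]) x.
  exact: (rhoNl hL _ _ (eval_smooth FQ sE)).
rewrite -[anchor_field Ls _ _ _]/(rho (sh phi0) (eval_form Q [seq extend v | v <- s]) x).
set T := \sum_(j < _) _; set T' := \sum_(j < _) _.
have -> : T = - T'.
  rewrite /T /T' -sumrN; apply: eq_bigr => j _; rewrite -mulrN; congr (_ * _).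
  rewrite /eval_form /= (bracketP_phi0 (smooth_all_nth j sE)) -[RHS]mulN1r.
    exact: (mlinZ [::] _ _ _ (form_mlin (x := x) FQ)).
rewrite /contract; ring.
Qed.

End PoissonCondition.
End TwistedBracket.

Theorem theorem5p1 (R : realType) (n : nat) (M : manifold R n) (r : nat)
    (A : vbundle M r) (L : algebroid_data A)
    (S : multivector A -> multivector A -> multivector A)
    (phi0 : vsection (dual A)) (P : multivector A)
    (hL : is_lie_algebroid L)
    (hS : is_schouten L S)
    (hphi0 : cocycle L phi0)
    (hP : is_multivector A 2 P)
    (hPP : forall (x : M) (s : seq (dual A x)),
       tschouten S phi0 2 2 P P x s = 0) :
  let Ls : algebroid_data (dual A) := dataP L phi0 P in
  let X0 : vsection A := fun x => - sharp_section P phi0 x in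
  is_lie_algebroid Ls /\
  dual_cocycle Ls X0 /\
  is_gen_lie_bialgebroid L S phi0 Ls X0.
Proof.
move=> Ls X0.
have hLs : is_lie_algebroid Ls := dataP_lie_algebroid hL hS hphi0 hP hPP.
have hX0 : dual_cocycle Ls X0 := X0_cocycle hL hS hphi0 hP hPP.
split=> //; split=> //; split=> // [X Y sX sY x s|k Q FQ x s].
  exact: (tdiff_bracket hL hS hphi0 hP hPP s sX sY).
exact: (tlie_phi0 hL hS hphi0 hP hPP s FQ).
Qed.
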